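(* Let $q\ge3$ be a prime power and $n$ a positive odd integer. For each integer $a$ with $2\le a\le q-1$, there exists an AG code over $\mathbb{F}_{q^{2n}}$ with parameters $$\left[q^{2n+1},\ a+\frac{a(a-1)q^{n-1}}{2},\ q^{2n+1}-(q^n+1)(a-1)\right].$$
   Context: A code with parameters $[N,k,d]$ over a finite field $\mathbb{F}$ is a linear subspace of $\mathbb{F}^N$ of dimension $k$ whose minimum Hamming distance is exactly $d$. An (algebraic geometry) AG code over $\mathbb{F}$ is a code of the form $C_{\mathcal{L}}(D,G)=\{(f(P_1),\dots,f(P_N))\mid f\in\mathcal{L}(G)\}\subseteq\mathbb{F}^N$, where $F/\mathbb{F}$ is a function field with full constant field $\mathbb{F}$, $D=P_1+\dots+P_N$ is a sum of pairwise distinct rational (degree-one) places, $G$ is a divisor of $F$ with support disjoint from that of $D$, and $\mathcal{L}(G)=\{z\in F\mid(z)+G\ge0\}\cup\{0\}$. *)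

(* Defs.v *)
From HB Require Import structures.
From mathcomp Require Import all_boot all_order all_algebra.
From mathcomp Require Import boolp classical_sets.
From mathcomp Require Import freeg.

Set Implicit Arguments.
Unset Strict Implicit.
Unset Printing Implicit Defensive.

Import GRing.Theory Num.Theory.
Local Open Scope classical_set_scope.
Local Open Scope ring_scope.

Definition prime_power (q : nat) : Prop :=
  exists p e : nat, [/\ prime p, (0 < e)%N & q = (p ^ e)%N].

(* The conventions on function fields follow Stichtenoth, "Algebraic Function
   Fields and Codes". An extension field F of K is given by its structure
   morphism iota : K -> F. *)
Section FunctionField.
Variables (K F : fieldType) (iota : {rmorphism K -> F}).

(* The subfield K(x) of F; a vanishing denominator yields 0 (as 0^-1 = 0),
   which adds no element. *)
Definition simple_ext (x : F) : set F :=
  [set z | exists p r : {poly K},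
     z = (map_poly iota p).[x] / (map_poly iota r).[x]].

Definition function_field : Prop :=
  exists2 x : F, ~ algebraicOver iota x &
    exists (m : nat) (b : 'I_m -> F), forall z : F,
      exists2 r : 'I_m -> F, (forall i, simple_ext x (r i)) &
        z = \sum_i r i * b i.

Definition full_constant_field : Prop :=
  forall z : F, algebraicOver iota z -> exists c : K, z = iota c.

(* Valuation rings of F/K: rings O with K < O < F, both inclusions strict. *)
Definition valuation_ring (O : set F) : Prop :=
  [/\ GRing.subring_closed (mem O), range iota `<` O, O `<` setT &
      forall z : F, O z \/ O z^-1].

(* A place P is stored through its valuation ring O_P, of which it is the
   maximal ideal (place_ideal below); P and O_P determine each other. *)
Record place : Type := Place {
  place_ring : set F;
  place_ringP : valuation_ring place_ring
}.

HB.instance Definition _ := gen_eqMixin place.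
HB.instance Definition _ := gen_choiceMixin place.

Implicit Type P : place.

Definition place_unit P : set F := [set z | [/\ z != 0, place_ring P z & place_ring P z^-1]].

Definition place_ideal P : set F := place_ring P `\` place_unit P.

Definition prime_element P (t : F) : Prop :=
  place_ideal P = [set t * u | u in place_ring P].

(* v_P(z) for z != 0: the unique m such that z = t^m u with t a prime element
   and u a unit of O_P. The value at z = 0 is meaningless (v_P(0) = +oo). *)
Definition valuation P (z : F) : int :=
  xget 0 [set m : int | exists t u : F,
            [/\ prime_element P t, place_unit P u & z = t ^ m * u]].

(* deg P = [O_P / P : K] = m: there is a family of m elements of O_P whose
   residue classes form a K-basis of O_P / P. *)
Definition place_degree P (m : nat) : Prop :=
  exists2 b : 'I_m -> F, (forall i, place_ring P (b i)) &
    forall z : F, place_ring P z ->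
      exists! c : {ffun 'I_m -> K},
        place_ideal P (z - \sum_i iota (c i) * b i).

Definition rational_place P : Prop := place_degree P 1%N.

(* The residue class f(P), seen in K; meaningful for P rational and f in O_P. *)
Definition place_eval P (f : F) : K :=
  xget 0 [set c : K | place_ideal P (f - iota c)].

Definition divisor : Type := {freeg place / int}.

Definition riemann_roch_space (G : divisor) : set F :=
  [set z | z = 0 \/ forall P, 0 <= valuation P z + coeff P G].

(* C_L(D, G) for D = P_0 + ... + P_(N-1); the order of the coordinates is that
   of the family P. *)
Definition ag_code (N : nat) (P : 'I_N -> place) (G : divisor) :
    set 'rV[K]_N :=
  [set \row_i place_eval (P i) f | f in riemann_roch_space G].

End FunctionField.

Section Codes.
Variables (K : fieldType) (N : nat).

Definition is_ag_code (C : {vspace 'rV[K]_N}) : Prop :=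
  exists (F : fieldType) (iota : {rmorphism K -> F})
         (P : 'I_N -> place iota) (G : divisor iota),
    [/\ function_field iota /\ full_constant_field iota,
        injective P,
        forall i, rational_place (P i),
        forall i, P i \notin dom G &
        forall c : 'rV[K]_N, c \in C <-> ag_code P G c].

Definition hamming_dist (x y : 'rV[K]_N) : nat := #|[pred i | x 0 i != y 0 i]|.

Definition min_distance (C : {vspace 'rV[K]_N}) (d : nat) : Prop :=
  (exists x y, [/\ x \in C, y \in C, x != y & hamming_dist x y = d]) /\
  (forall x y, x \in C -> y \in C -> x != y -> (d <= hamming_dist x y)%N).

Definition code_parameters (C : {vspace 'rV[K]_N}) (k d : nat) : Prop :=
  \dim C = k /\ min_distance C d.

End Codes.

(* Main.v *)
Require Import Defs.
From HB Require Import structures.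
From mathcomp Require Import all_boot all_order all_algebra all_field.
From mathcomp Require Import boolp classical_sets freeg ring zify.

(** The code is a one-point code on the curve y^q + y = x^M with M = q^n + 1.

    Since n is odd, x^M lies in the field with q^n elements whenever x is in K,
    and every element c of that subfield is b^q + b for exactly q elements b of
    K ([card_artin_schreier]). So the curve has q * #|K| = q^(2n+1) affine points
    over K. It has a single place at infinity Pinf, where x and y have poles of
    orders q and M; the code evaluates the functions of L((a-1)M Pinf) at all the
    affine points.

    A function whose only pole is Pinf is a polynomial in x and y
    ([regular_polynomial]), which can be reduced to degree less than q in y. The
    monomials x^i y^j with j < q have pairwise distinct pole orders q i + M j,
    because q and M are coprime, so the order of a reduced polynomial is that of
    its leading monomial. Hence L(m Pinf) is spanned by the monomials with
    q i + M j <= m, and for m = (a-1)M counting them gives the dimension. A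
    function with pole order w at Pinf has at most w affine zeros ([zero_bound]),
    and the product of y - b, for b among a-1 of the q roots of b^q + b = 1, has
    exactly (a-1)M of them; this gives the distance.

    Three points replace general results on function fields.

    The field F = K(x, y) is obtained from any irreducible factor of the equation
    over K(x), and a place at infinity from an extension theorem for places
    ([place_extension], by maximality of the subrings in which x is not
    contained). At any place where x has a pole, t = x^(q^(n-1)) / y satisfies
    t^q x = unit and t^M y = unit, so that a reduced polynomial is a power of t,
    given by its leading monomial, times a unit. This yields at once that 1, y,
    ..., y^(q-1) are independent over K(x) (so that the chosen factor was the
    whole equation), that t is a prime element, and that the place at infinity
    is unique.

    A point (a, b) of the curve, over a finite extension of K, gives a place
    through its local ring. A prime element is p(x), with p the minimal polynomial
    of a: this is the smoothness of the curve, and holds because the fibre over a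
    consists of the q distinct points (a, b + g), g^q + g = 0. These places
    detect the denominators of functions.

    The bound on the number of zeros is obtained by linear algebra. If f had too
    many zeros, there would be a polynomial g, with monomials in a suitable set,
    that vanishes at all the other points; then f g would be a multiple of
    x^#|K| - x, which the choice of the monomials makes impossible at the level of
    pole orders. *)

Set Implicit Arguments.
Unset Strict Implicit.
Unset Printing Implicit Defensive.

Import Order.TTheory GRing.Theory Num.Theory.
Local Open Scope ring_scope.

(** * Places of a function field *)

Section Subrings.
Variables (R : nzRingType) (A : set R).
Hypothesis subA : GRing.subring_closed (mem A).

Lemma subring1 : A 1.
Proof. by have [/set_mem] := subA. Qed.

Lemma subringB z u : A z -> A u -> A (z - u).
Proof. by have [_ B _] := subA; move=> *; apply/set_mem/B; apply: mem_set. Qed.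

Lemma subringM z u : A z -> A u -> A (z * u).
Proof. by have [_ _ M] := subA; move=> *; apply/set_mem/M; apply: mem_set. Qed.

Lemma subring0 : A 0.
Proof. by rewrite -(subrr 1); apply: subringB; apply: subring1. Qed.

Lemma subringN z : A z -> A (- z).
Proof. by rewrite -sub0r; apply: subringB; apply: subring0. Qed.

Lemma subringD z u : A z -> A u -> A (z + u).
Proof. by move=> Az Au; rewrite -(opprK u); apply/subringB/subringN. Qed.

Lemma subringX z n : A z -> A (z ^+ n).
Proof.
move=> Az; elim: n => [|n IH]; first exact: subring1.
by rewrite exprS; apply: subringM.
Qed.

Lemma subring_sum (I : Type) (r : seq I) (p : pred I) (f : I -> R) :
  (forall i, p i -> A (f i)) -> A (\sum_(i <- r | p i) f i).
Proof.
move=> Af; apply: (big_ind (fun z => A z)) => //; first exact: subring0.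
exact: subringD.
Qed.

End Subrings.

Lemma subring_closed_set (R : nzRingType) (A : set R) :
  A 1 -> (forall z u, A z -> A u -> A (z - u)) ->
  (forall z u, A z -> A u -> A (z * u)) -> GRing.subring_closed (mem A).
Proof.
move=> A1 AB AM; split=> [|z u Az Au|z u Az Au]; apply: mem_set => //.
  by apply: AB; apply: set_mem.
by apply: AM; apply: set_mem.
Qed.

Section Places.
Variables (K F : fieldType) (iota : {rmorphism K -> F}).
Implicit Types (P : place iota) (z t u : F).

Lemma place_subring P : GRing.subring_closed (mem (place_ring P)).
Proof. by have [] := place_ringP P. Qed.

Definition place_ring0 P := subring0 (place_subring P).
Definition place_ring1 P := subring1 (place_subring P).
Definition place_ringB P := subringB (place_subring P).
Definition place_ringN P := subringN (place_subring P).
Definition place_ringD P := subringD (place_subring P).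
Definition place_ringM P := subringM (place_subring P).
Definition place_ringX P := subringX (place_subring P).
Definition place_ring_sum P := subring_sum (place_subring P).

Lemma place_ringV P z : place_ring P z \/ place_ring P z^-1.
Proof. by have [_ _ _] := place_ringP P. Qed.

Lemma place_ring_iota P c : place_ring P (iota c).
Proof. by have [_ [iotaP _] _ _] := place_ringP P; apply: iotaP; exists c. Qed.

(** As O_P is a valuation ring, its nonunits are 0 and the inverses of the elements
    outside O_P; this form makes the ideal properties short. *)
Lemma place_idealP P z : place_ideal P z <-> z = 0 \/ ~ place_ring P z^-1.
Proof.
split=> [[Pz nPu]|[->|nPz]].
- have [-> | z0] := eqVneq z 0; [by left | right => PVz].
  by apply: nPu; split.
- by split; [apply: place_ring0 | case; rewrite eqxx].
- split; last by case.
  by case: (place_ringV P z).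
Qed.

Lemma place_ideal_ring P z : place_ideal P z -> place_ring P z.
Proof. by case. Qed.

Lemma place_ideal0 P : place_ideal P 0.
Proof. by apply/place_idealP; left. Qed.

Lemma place_idealM P z u : place_ideal P z -> place_ring P u -> place_ideal P (z * u).
Proof.
move=> /place_idealP Pz Pu; apply/place_idealP; case: Pz => [->|nPz].
  by left; rewrite mul0r.
have [-> | u0] := eqVneq u 0; first by left; rewrite mulr0.
right=> PV; apply: nPz.
by have := place_ringM PV Pu; rewrite invfM mulfVK.
Qed.

(** One of z / u and u / z lies in O_P, so that z + u is a multiple, by an element
    of O_P, of u or of z. *)
Lemma place_idealD P z u : place_ideal P z -> place_ideal P u -> place_ideal P (z + u).
Proof.
have wlog_case a b : place_ring P (a / b) -> place_ideal P a -> place_ideal P b ->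
  place_ideal P (a + b).
  move=> Pab Pa Pb; have [b0 | b0] := eqVneq b 0; first by rewrite b0 addr0.
  rewrite [a + b](_ : _ = b * (a / b + 1)); last by field.
  by apply/place_idealM/place_ringD/place_ring1.
move=> Pz Pu; case: (place_ringV P (z / u)) => Pzu; first exact: wlog_case.
by rewrite addrC; apply: wlog_case => //; rewrite -(invf_div z).
Qed.

Lemma place_idealN P z : place_ideal P z -> place_ideal P (- z).
Proof. by rewrite -mulrN1 => Pz; apply/place_idealM/place_ringN/place_ring1. Qed.

Lemma place_ideal1 P : ~ place_ideal P 1.
Proof.
by move=> /place_idealP[/eqP|]; rewrite ?oner_eq0 ?invr1 //; apply; apply: place_ring1.
Qed.

Lemma place_unitM P z u : place_unit P z -> place_unit P u -> place_unit P (z * u).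
Proof.
move=> [z0 Pz PVz] [u0 Pu PVu]; split; first by rewrite mulf_neq0.
  exact: place_ringM.
by rewrite invfM; apply: place_ringM.
Qed.

Lemma place_unitV P z : place_unit P z -> place_unit P z^-1.
Proof. by case=> z0 Pz PVz; split; rewrite ?invr_eq0 ?invrK. Qed.

Lemma place_unit1 P : place_unit P 1.
Proof. by split; rewrite ?oner_eq0 ?invr1 //; apply: place_ring1. Qed.

Lemma place_unitX P z n : place_unit P z -> place_unit P (z ^+ n).
Proof.
move=> Pz; elim: n => [|n IH]; last by rewrite exprS; apply: place_unitM.
exact: place_unit1.
Qed.

Lemma place_unitXz P z (m : int) : place_unit P z -> place_unit P (z ^ m).
Proof. by case: m => n Pz; [|apply: place_unitV]; apply: place_unitX. Qed.

Lemma place_unit_iota P c : c != 0 -> place_unit P (iota c).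
Proof.
by move=> c0; split; rewrite ?fmorph_eq0 -?fmorphV //; apply: place_ring_iota.
Qed.

Lemma place_unit_ideal P z : place_unit P z -> ~ place_ideal P z.
Proof. by move=> Uz [_ /(_ Uz)]. Qed.

Lemma place_unit_or_ideal P z : place_ring P z -> place_unit P z \/ place_ideal P z.
Proof. by move=> Pz; have [|] := pselect (place_unit P z); [left|right; split]. Qed.

Lemma place_unitD P z u : place_unit P z -> place_ideal P u -> place_unit P (z + u).
Proof.
move=> Uz Pu; have [z0 Pz _] := Uz.
case: (place_unit_or_ideal (place_ringD Pz (place_ideal_ring Pu))) => // Pzu.
case: (place_unit_ideal Uz); rewrite -(addrK u z).
exact/place_idealD/place_idealN.
Qed.

Lemma place_ideal_sum P (I : Type) (r : seq I) (p : pred I) (f : I -> F) :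
  (forall i, p i -> place_ideal P (f i)) -> place_ideal P (\sum_(i <- r | p i) f i).
Proof.
move=> Pf; apply: (big_ind (fun z => place_ideal P z)) => //; first exact: place_ideal0.
exact: place_idealD.
Qed.

Lemma place_idealX P z n : place_ideal P z -> (0 < n)%N -> place_ideal P (z ^+ n).
Proof.
case: n => // n Pz _; rewrite exprS; apply: place_idealM => //.
exact/place_ringX/place_ideal_ring.
Qed.

Lemma place_ideal_exp P z n : (0 < n)%N -> place_ideal P (z ^+ n) -> place_ideal P z.
Proof.
case: n => // n _ /place_idealP[/eqP|nP].
  by rewrite expf_eq0 /= => /eqP ->; apply: place_ideal0.
by apply/place_idealP; right=> PV; apply: nP; rewrite -exprVn; apply: place_ringX.
Qed.

(** If z is not in O_P then 1 / z is in the ideal, and dividing the equation by the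
    top power of z writes -1 as an element of the ideal. *)
Lemma place_ring_integral P (p : {poly F}) z : p \is monic -> root p z ->
  (forall i, place_ring P p`_i) -> place_ring P z.
Proof.
move=> mp rp Pp; apply: contrapT => nPz.
have z0 : z != 0 by apply/eqP => z0; apply: nPz; rewrite z0; apply: place_ring0.
have Pw : place_ideal P z^-1 by apply/place_idealP; right; rewrite invrK.
have sp : (0 < (size p).-1)%N.
  rewrite -subn1 subn_gt0 ltnNge; apply/negP => s1.
  move: rp mp; rewrite (size1_polyC s1) /root hornerC monicE lead_coefC => /eqP ->.
  by rewrite eq_sym oner_eq0.
have szp : size p = (size p).-1.+1 by rewrite prednK // (leq_trans sp) ?leq_pred.
have : p.[z] * z^-1 ^+ (size p).-1 = 0 by rewrite (eqP rp) mul0r.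
rewrite horner_coef szp big_ord_recr /= -lead_coefE (monicP mp) mul1r.
rewrite mulrDl exprVn divff ?expf_neq0 // => /(canRL (addrK _)); rewrite sub0r => e1.
apply: (@place_ideal1 P); rewrite -(opprK 1); apply: place_idealN; rewrite -e1 big_distrl /=.
apply: place_ideal_sum => i _.
rewrite -mulrA mulrC; apply: place_idealM => //.
rewrite [_ * _](_ : _ = z^-1 ^+ ((size p).-1 - i)).
  by apply: place_idealX; rewrite // subn_gt0.
by rewrite exprVn expfB_cond ?invf_div // (negPf z0); apply: (ltnW (ltn_ord i)).
Qed.

Lemma place_inj P P' : place_ring P = place_ring P' -> P = P'.
Proof.
case: P P' => [O HO] [O' HO'] /= e; case: O' / e HO' => HO'.
by congr Place; apply: Prop_irrelevance.
Qed.

Section PrimeElement.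
Variables (P : place iota) (t : F).
Hypothesis Pt : prime_element P t.

Lemma prime_element_ideal : place_ideal P t.
Proof. by rewrite Pt; exists 1; [apply: place_ring1 | rewrite mulr1]. Qed.

Lemma prime_element_neq0 : t != 0.
Proof.
apply/eqP => t0; have [_ _ [_ nT] _] := place_ringP P.
apply: nT => z _; have [->|z0] := eqVneq z 0; first exact: place_ring0.
apply: contrapT => nPz.
have : place_ideal P z^-1 by apply/place_idealP; right; rewrite invrK.
by rewrite Pt => -[u _]; rewrite t0 mul0r => /esym/eqP; rewrite invr_eq0 (negPf z0).
Qed.

Lemma unit_exp_ring (m : int) u : place_unit P u -> place_ring P (t ^ m * u) <-> 0 <= m.
Proof.
move=> Uu; have [u0 Pu PVu] := Uu; have Pit := prime_element_ideal; have t0 := prime_element_neq0.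
case: m => n; split=> //.
- by move=> _; apply: place_ringM => //; apply/place_ringX/place_ideal_ring.
move=> H; case: (@place_ideal1 P).
have := place_idealM (place_idealX Pit (ltn0Sn n)) (place_ringM H PVu).
by rewrite mulfK // NegzE -exprnN mulfV // expf_eq0 (negPf t0).
Qed.

(** Two prime elements differ by a unit, and a power of a prime element is a unit
    only for the exponent 0: the exponent m is determined by the element. *)
Lemma valuationE (m : int) u : place_unit P u -> valuation P (t ^ m * u) = m.
Proof.
move=> Uu; apply: xget_unique => [|k [t' [u' [Pt' Uu' e]]]]; first by exists t, u; split.
have t0 := prime_element_neq0; have [u0 _ _] := Uu; have [u'0 _ _] := Uu'.
have [w Uw t'E] : exists2 w, place_unit P w & t' = t * w.
  have Pit' : place_ideal P t'.
    by rewrite Pt'; exists 1; [apply: place_ring1 | rewrite mulr1].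
  have : place_ideal P t by exact: prime_element_ideal.
  (* Each of t and t' is a multiple of the other in O_P. *)
  rewrite Pt' => -[a Pa tE]; move: Pit'; rewrite {1}Pt => -[b Pb t'E].
  exists b => //; have e1 : a * b = 1.
    by apply: (mulfI t0); rewrite mulr1 mulrCA mulrC -{2}tE -t'E mulrC.
  have b0 : b != 0 by apply/eqP => b0; move/eqP: e1; rewrite b0 mulr0 eq_sym oner_eq0.
  by split=> //; rewrite -(mulr1 b^-1) -e1 mulrC mulfK.
have e2 : t ^ (m - k) = w ^ k * u' / u.
  apply: (mulIf u0); rewrite divfK //; apply: (mulfI (expfz_neq0 k t0)).
  by rewrite mulrA -expfzDr // addrC subrK e t'E expfzMl mulrA.
have Ue : place_unit P (t ^ (m - k)).
  by rewrite e2; apply/place_unitM/place_unitV => //; apply: place_unitM => //; apply: place_unitXz.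
have := unit_exp_ring (m - k) (place_unit1 P); have := unit_exp_ring (- (m - k)) (place_unit1 P).
rewrite -invr_expz !mulr1; case: Ue => _ Pe PVe [/(_ PVe) h1 _] [/(_ Pe) h2 _].
by apply/eqP; rewrite eq_sym -subr_eq0 eq_le h2 -oppr_ge0 h1.
Qed.

End PrimeElement.

(** Holds for every place: if no prime element exists, the valuation is 0 by
    default, and otherwise z = t^m u with m negative would make t a unit. *)
Lemma valuation_ge0 P z : place_ring P z -> 0 <= valuation P z.
Proof.
rewrite /valuation => Pz; case: xgetP => // m _ [t [u [Pt Uu zE]]].
by apply/(unit_exp_ring Pt m Uu); rewrite -zE.
Qed.

End Places.

(** * Extending a place *)

Section Chevalley.
Variable F : fieldType.
Implicit Types (A B S : set F) (z w : F).

Definition adjoin A z : set F :=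
  [set u | exists2 p : {poly F}, forall i, A p`_i & u = p.[z]].

Section Adjoin.
Variables (A : set F) (z : F).
Hypothesis subA : GRing.subring_closed (mem A).

Lemma adjoin_subring : GRing.subring_closed (mem (adjoin A z)).
Proof.
apply: subring_closed_set => [|_ _ [p Ap ->] [r Ar ->]|_ _ [p Ap ->] [r Ar ->]].
- exists 1; last by rewrite hornerC.
  by move=> i; rewrite coef1; case: (i == 0)%N; [apply: subring1 | apply: subring0].
- exists (p - r); last by rewrite hornerD hornerN.
  by move=> i; rewrite coefB; apply: subringB.
- exists (p * r); last by rewrite hornerM.
  by move=> i; rewrite coefM; apply: subring_sum => // j _; apply: subringM.
Qed.

Lemma adjoin_sub : (A `<=` adjoin A z)%classic.
Proof.
move=> a Aa; exists a%:P; last by rewrite hornerC.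
by move=> i; rewrite coefC; case: (i == 0)%N => //; apply: subring0.
Qed.

Lemma adjoin_gen : adjoin A z z.
Proof.
exists 'X; last by rewrite hornerX.
by move=> i; rewrite coefX; case: (i == 1)%N; [apply: subring1 | apply: subring0].
Qed.

End Adjoin.

(** For 1 / w in S, these are the rings above S in which 1 / w is not invertible; a
    maximal one is a valuation ring. *)
Definition avoiding S w A : Prop :=
  [/\ GRing.subring_closed (mem A), (S `<=` A)%classic & ~ A w].

Lemma maximal_avoiding S w : avoiding S w S ->
  exists2 A, avoiding S w A & forall B, avoiding S w B -> (A `<=` B)%classic -> B = A.
Proof.
move=> avS.
have [Fs FsP Fstot|A [PA Amax]] :=
    @Zorn_bigcup _ [set B | B = set0 \/ avoiding S w B]%classic.
  have [[X FX avX]|noX] := pselect (exists2 X, Fs X & avoiding S w X); last first.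
    left; rewrite -subset0 => z [X FX Xz]; have [X0|avX] := FsP _ FX.
      by rewrite X0 in Xz.
    by case: noX; exists X.
  have both z u : (\bigcup_(X in Fs) X)%classic z -> (\bigcup_(X in Fs) X)%classic u ->
      exists2 Y, Fs Y & [/\ avoiding S w Y, Y z & Y u].
    move=> [Y FY Yz] [Z FZ Zu].
    have av V v : Fs V -> V v -> avoiding S w V.
      by move=> /FsP[->|].
    have [YZ|ZY] := Fstot _ _ FY FZ.
      by exists Z => //; split; [apply: av FZ Zu | apply: YZ|].
    by exists Y => //; split; [apply: av FY Yz | | apply: ZY].
  right; have [subX SX nX] := avX; split.
  - apply: subring_closed_set; first by exists X => //; apply: subring1.
    + move=> z u Az Au; have [Y FY [[sY _ _] Yz Yu]] := both _ _ Az Au.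
      by exists Y => //; apply: subringB.
    + move=> z u Az Au; have [Y FY [[sY _ _] Yz Yu]] := both _ _ Az Au.
      by exists Y => //; apply: subringM.
  - by move=> z Sz; exists X => //; apply: SX.
  - by move=> Aw; have [Y _ [[]]] := both _ _ Aw Aw.
have [subS _ _] := avS.
have avA : avoiding S w A.
  case: PA => // A0; case: (Amax S); last by right.
  split; first by rewrite A0.
  by rewrite A0 => /(_ _ (subring1 subS)).
exists A => // B avB AB; apply: contrapT => neq.
apply: (Amax B); last by right.
by split=> // BA; apply: neq; apply/seteqP.
Qed.

Section Maximal.
Variables (S A : set F) (pi : F).
Hypotheses (avA : avoiding S pi^-1 A) (Spi : S pi).
Hypothesis Amax : forall B, avoiding S pi^-1 B -> (A `<=` B)%classic -> B = A.

Let subA : GRing.subring_closed (mem A). Proof. by have [] := avA. Qed.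
Let SA : (S `<=` A)%classic. Proof. by have [] := avA. Qed.
Let nA : ~ A pi^-1. Proof. by have [] := avA. Qed.
Let pi0 : pi != 0.
Proof. by apply/eqP => pi0; apply: nA; rewrite pi0 invr0; apply: subring0. Qed.

Lemma maximal_adjoin z : ~ A z -> adjoin A z pi^-1.
Proof.
move=> nAz; apply: contrapT => nz; apply: nAz.
rewrite -(Amax (B := adjoin A z)); first exact: adjoin_gen.
  split=> //; first exact: adjoin_subring.
  by move=> u /SA Au; apply: adjoin_sub.
exact: adjoin_sub.
Qed.

(** Otherwise 1 / (1 - pi c) could be adjoined without reaching 1 / pi: clearing
    denominators in a polynomial expression of 1 / pi would give (1 - pi c)^k / pi,
    hence 1 / pi, in A. *)
Lemma maximal_unit c : A c -> A (1 - pi * c)^-1.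
Proof.
move=> Ac; set w := 1 - pi * c.
have Api : A pi by apply: SA.
(* Powers of 1 - pi c keep this form. *)
have wX n : exists2 b, A b & w ^+ n = 1 - pi * b.
  elim: n => [|n [b Ab e]]; first by exists 0; [apply: subring0 | rewrite mulr0 subr0].
  exists (b + c * (1 - pi * b)); last by rewrite exprS e /w; ring.
  by apply: subringD => //; do ?[apply: subringM | apply: subringB] => //; apply: subring1.
have w0 : w != 0.
  apply/eqP => /eqP; rewrite subr_eq0 => /eqP e; apply: nA.
  by rewrite -[pi^-1]mulr1 e mulrA mulVf // mul1r.
apply: contrapT => /maximal_adjoin[p Ap e].
have Aw : A w by apply: subringB => //; [apply: subring1 | apply: subringM].
have : A (pi^-1 * w ^+ size p).
  rewrite e horner_coef big_distrl /=; apply: subring_sum => // i _.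
  rewrite -mulrA exprVn; apply: subringM => //.
  rewrite mulrC -expfB_cond ?(negPf w0); last exact: (ltnW (ltn_ord i)).
  exact: subringX.
have [b Ab ->] := wX (size p); rewrite mulrBr mulr1 mulrA mulVf // mul1r => Ab'.
by apply: nA; rewrite -(subrK b pi^-1); apply: subringD.
Qed.

(** The classical descent for valuation rings. The relation of degree l in 1 / z,
    whose constant term can be normalised by [maximal_unit], expresses z^m by
    lower powers of z when l <= m, which lowers the degree m of the relation in z;
    the roles of z and 1 / z are exchanged in the other case. *)
Lemma maximal_no_relations m l z (p r : {poly F}) :
  (forall i, A p`_i) -> (forall i, A r`_i) -> (size p <= m.+1)%N -> (size r <= l.+1)%N ->
  p.[z] = pi^-1 -> r.[z^-1] = pi^-1 -> z != 0 -> False.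
Proof.
have [k] := ubnP (m + l).
elim: k m l z p r => // k IH m l z p r lt_k Ap Ar sp sr pz rz z0.
wlog lm : m l z p r lt_k Ap Ar sp sr pz rz z0 / (l <= m)%N.
  move=> H; have /orP[lm|lm] := leq_total l m; first exact: (H m l z p r).
  by apply: (H l m z^-1 r p); rewrite ?invrK ?invr_eq0 // addnC.
have Api : A pi by apply: SA.
case: m => [|m] in lt_k sp lm.
  by apply: nA; rewrite -pz (size1_polyC sp) hornerC.
pose w := 1 - pi * r`_0; have Aw : A w^-1 by apply: maximal_unit.
have w0 : w != 0.
  apply/eqP => /eqP; rewrite subr_eq0 => /eqP e; apply: nA.
  by rewrite -[pi^-1]mulr1 e mulrA mulVf // mul1r.
(* The relation in 1 / z, with its constant term moved to the left. *)
have wE : w = \sum_(j < l) pi * r`_j.+1 * z^-1 ^+ j.+1.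
  rewrite /w -[1](mulfV pi0) -rz (horner_coef_wide _ sr) big_ord_recl /= expr0 mulr1.
  rewrite mulrDr addrAC subrr add0r big_distrr /=.
  by apply: eq_bigr => j _; rewrite mulrA.
(* z^(m+1) as a polynomial of degree at most m in z. *)
pose q := \sum_(j < l) (pi * r`_j.+1 / w) *: 'X^(m - j).
have qz : q.[z] = z ^+ m.+1.
  have -> : z ^+ m.+1 = w * (w^-1 * z ^+ m.+1) by rewrite mulVKf.
  rewrite {1}wE horner_sum big_distrl /=.
  apply: eq_bigr => j _; rewrite hornerZ hornerXn.
  have jm : (j <= m)%N by rewrite -ltnS; apply: leq_trans (ltn_ord j) lm.
  rewrite -(subSS j m) expfB_cond ?(negPf z0) //.
  by rewrite exprVn; ring.
pose p' := \sum_(i < m.+1) p`_i *: 'X^i + p`_m.+1 *: q.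
apply: (IH m l z p' r) => //.
- move=> i; rewrite coefD coefZ !coef_sum; apply: subringD => //; last apply: subringM => //.
    apply: subring_sum => // j _; rewrite coefZ coefXn mulr_natr mulrb.
    by case: ifP => // _; apply: subring0.
  apply: subring_sum => // j _; rewrite coefZ coefXn mulr_natr mulrb.
  case: ifP => _; last exact: subring0.
  by do ?apply: subringM.
- have sX (I : finType) (f : I -> F) (g : I -> nat) : (forall i, g i <= m)%N ->
      (size (\sum_(i : I) f i *: 'X^(g i))%R <= m.+1)%N.
    move=> gm; apply: (big_ind (fun p : {poly F} => size p <= m.+1)%N).
    - by rewrite size_poly0.
    - move=> a b sa sb; apply: leq_trans (size_polyD _ _) _.
      by rewrite geq_max sa.
    - by move=> i _; rewrite (leq_trans (size_scale_leq _ _)) // size_polyXn ltnS.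
  apply: leq_trans (size_polyD _ _) _; rewrite geq_max sX; last by move=> i; rewrite -ltnS.
  apply: leq_trans (size_scale_leq _ _) _; apply: sX => i; exact: leq_subr.
- rewrite -pz (horner_coef_wide _ sp) big_ord_recr /= hornerD hornerZ qz horner_sum.
  by congr (_ + _); apply: eq_bigr => i _; rewrite hornerZ hornerXn.
Qed.

Lemma maximal_dichotomy z : A z \/ A z^-1.
Proof.
have [->|z0] := eqVneq z 0; first by left; apply: subring0.
apply: contrapT => /not_orP[/maximal_adjoin[p Ap pz] /maximal_adjoin[r Ar rz]].
exact: (@maximal_no_relations (size p) (size r) z p r).
Qed.

End Maximal.

(** Chevalley's extension theorem, for an ideal generated by one element pi. *)
Lemma place_extension (K : fieldType) (iota : {rmorphism K -> F}) S pi :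
  GRing.subring_closed (mem S) -> (range iota `<=` S)%classic -> S pi -> ~ S pi^-1 ->
  exists2 P : place iota, (S `<=` place_ring P)%classic & place_ideal P pi.
Proof.
move=> subS iS Spi nS.
have [A avA Amax] : exists2 A, avoiding S pi^-1 A &
    forall B, avoiding S pi^-1 B -> (A `<=` B)%classic -> B = A.
  by apply: maximal_avoiding; split.
have [subA SA nA] := avA.
have vA : valuation_ring iota A.
  split=> //.
  - split=> [z /iS /SA //|iA]; apply: nA.
    have /iA[c _ <-] := SA _ Spi.
    by rewrite -fmorphV; apply/SA/iS; exists c^-1.
  - by split=> // /(_ pi^-1 I).
  - exact: (maximal_dichotomy avA Spi Amax).
exists (Place vA) => //; apply/place_idealP.
by right.
Qed.

End Chevalley.

(** * Polynomials on the curve and its places at infinity *)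

Section Eval2.
Variables (K R : fieldType) (j : {rmorphism K -> R}) (a b : R).

(** The value f(a, b), where the outer variable of f is y and the inner one is x. *)
Definition eval2 (f : {poly {poly K}}) : R :=
  (map_poly (horner_eval a \o map_poly j) f).[b].

HB.instance Definition _ := GRing.RMorphism.copy eval2
  (horner_eval b \o map_poly (horner_eval a \o map_poly j)).

Lemma eval2_0 : eval2 0 = 0. Proof. exact: rmorph0. Qed.
Lemma eval2_1 : eval2 1 = 1. Proof. exact: rmorph1. Qed.
Lemma eval2D : {morph eval2 : f g / f + g}. Proof. exact: rmorphD. Qed.
Lemma eval2B : {morph eval2 : f g / f - g}. Proof. exact: rmorphB. Qed.
Lemma eval2M : {morph eval2 : f g / f * g}. Proof. exact: rmorphM. Qed.
Lemma eval2Xn n : {morph eval2 : f / f ^+ n}. Proof. exact: rmorphXn. Qed.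

Lemma eval2_polyC d : eval2 d%:P = (map_poly j d).[a].
Proof. by rewrite /eval2 map_polyC hornerC. Qed.

Lemma eval2_const c : eval2 c%:P%:P = j c.
Proof. by rewrite eval2_polyC map_polyC hornerC. Qed.

Lemma eval2_X : eval2 'X%:P = a.
Proof. by rewrite eval2_polyC map_polyX hornerX. Qed.

Lemma eval2_Y : eval2 'X = b.
Proof. by rewrite /eval2 map_polyX hornerX. Qed.

Lemma eval2_coef (f : {poly {poly K}}) n : (size f <= n)%N ->
  eval2 f = \sum_(i < n) (map_poly j f`_i).[a] * b ^+ i.
Proof.
move=> sf; rewrite /eval2 (horner_coef_wide (n := n)); last first.
  exact: leq_trans (size_poly _ _) sf.
by apply: eq_bigr => i _; rewrite coef_map.
Qed.

Lemma eval2_coef2 (f : {poly {poly K}}) n m : (size f <= n)%N ->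
  (forall i, size (f`_i)%R <= m)%N ->
  eval2 f = \sum_(p : 'I_n * 'I_m) j f`_p.1`_p.2 * (a ^+ p.2 * b ^+ p.1).
Proof.
move=> sf sf'; rewrite (eval2_coef sf).
rewrite -(pair_bigA _ (fun (i : 'I_n) (k : 'I_m) => j f`_i`_k * (a ^+ k * b ^+ i))) /=.
apply: eq_bigr => i _; rewrite (horner_coef_wide (n := m)); last first.
  by rewrite size_map_poly.
by rewrite big_distrl /=; apply: eq_bigr => k _; rewrite coef_map mulrA.
Qed.

End Eval2.

Section Xsize.
Variables (K : nzRingType).
Implicit Type f : {poly {poly K}}.

(** One more than the degree of f in x. *)
Definition xsize f : nat := (\max_(i < size f) size (f`_i)%R)%N.

Lemma size_coef_xsize f i : (size (f`_i)%R <= xsize f)%N.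
Proof.
have [li|gi] := ltnP i (size f); last by rewrite nth_default ?size_poly0.
exact: (leq_bigmax (F := fun i : 'I_(size f) => size (f`_i)%R) (Ordinal li)).
Qed.

Lemma coef2_neq0 f i j : f`_j`_i != 0 -> (i < xsize f)%N /\ (j < size f)%N.
Proof.
move=> c0; split; rewrite ltnNge; apply/negP => H; move/eqP: c0; apply.
  by rewrite [_`_i]nth_default // (leq_trans (size_coef_xsize _ _) H).
by rewrite (nth_default _ H) coef0.
Qed.

End Xsize.

Section CurvePoly.
Variables (K : fieldType) (q M : nat).
Hypothesis q_gt1 : (1 < q)%N.

Definition curve_poly : {poly {poly K}} := 'X^q + ('X - ('X^M)%:P).

Lemma size_curve_poly : size curve_poly = q.+1.
Proof. by rewrite size_polyDl size_polyXn // size_XsubC. Qed.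

Lemma curve_poly_monic : curve_poly \is monic.
Proof.
by rewrite monicE lead_coefDl ?lead_coefXn // size_polyXn size_XsubC ltnS.
Qed.

Lemma eval2_curve_poly (R : fieldType) (j : {rmorphism K -> R}) a b :
  eval2 j a b curve_poly = b ^+ q + b - a ^+ M.
Proof.
rewrite rmorphD rmorphB rmorphXn /= !eval2_Y eval2_polyC map_polyXn hornerXn.
by rewrite addrA.
Qed.

Definition curve_mod (f : {poly {poly K}}) : {poly {poly K}} :=
  Pdiv.CommonRing.rmodp f curve_poly.

Lemma size_curve_mod f : (size (curve_mod f) <= q)%N.
Proof.
rewrite -ltnS -size_curve_poly Pdiv.CommonRing.ltn_rmodp.
exact/monic_neq0/curve_poly_monic.
Qed.

Lemma eval2_curve_mod (R : fieldType) (j : {rmorphism K -> R}) a b f :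
  b ^+ q + b = a ^+ M -> eval2 j a b (curve_mod f) = eval2 j a b f.
Proof.
move=> ab; rewrite [in RHS](Pdiv.RingMonic.rdivp_eq curve_poly_monic f).
by rewrite rmorphD rmorphM /= eval2_curve_poly ab subrr mulr0 add0r.
Qed.

End CurvePoly.

Section Weights.
Variables (q M : nat).

(** The pole order of x^i y^j at infinity. *)
Definition weight (i j : nat) : nat := (q * i + M * j)%N.

Definition leading (K : fieldType) (f : {poly {poly K}}) (i0 j0 : nat) : Prop :=
  [/\ (j0 < q)%N, f`_j0`_i0 != 0 &
      forall i j, f`_j`_i != 0 -> (i, j) != (i0, j0) -> (weight i j < weight i0 j0)%N].

Variable s : nat.
Hypothesis M_def : M = (q * s + 1)%N.

(** M is 1 modulo q, so the weight determines j modulo q, and j < q. *)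
Lemma weight_inj i j i' j' : (j < q)%N -> (j' < q)%N ->
  weight i j = weight i' j' -> (i, j) = (i', j').
Proof.
rewrite /weight M_def => jq j'q e.
have ej : j = j'.
  have : (q * (i + s * j) + j = q * (i' + s * j') + j')%N by move: e; lia.
  move/(congr1 (modn^~ q)); rewrite ![(q * _)%N]mulnC !modnMDl !modn_small //.
by rewrite -ej in e *; congr (_, _); nia.
Qed.

Lemma leading_exists (K : fieldType) (f : {poly {poly K}}) : f != 0 -> (size f <= q)%N ->
  exists i0 j0, leading f i0 j0.
Proof.
move=> f0 sf; pose D := xsize f.
have in_box i j : f`_j`_i != 0 -> (i < D)%N /\ (j < q)%N.
  by move=> /coef2_neq0[li lj]; rewrite (leq_trans lj sf).
pose nz (p : 'I_D * 'I_q) := f`_p.2`_p.1 != 0.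
have [p0 Pp0] : exists p, nz p.
  have := f0; rewrite -lead_coef_eq0 -lead_coef_eq0 => c0.
  have [l1 l2] := in_box _ _ c0.
  by exists (Ordinal l1, Ordinal l2).
case: (arg_maxnP (fun p : 'I_D * 'I_q => weight p.1 p.2) Pp0) => -[i0 j0] /= c0 Pmax.
exists i0, j0; split=> // i j cij nij.
have [l1 l2] := in_box _ _ cij.
have := Pmax (Ordinal l1, Ordinal l2) cij; rewrite /= leq_eqVlt => /orP[/eqP e|//].
by move/eqP: nij; case; apply: weight_inj.
Qed.

End Weights.

Section Infinity.
Variables (K F : fieldType) (iota : {rmorphism K -> F}) (q s M : nat) (x y : F).
Hypotheses (q_gt1 : (1 < q)%N) (M_def : M = (q * s + 1)%N).
Hypothesis x_tr : ~ algebraicOver iota x.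
Hypothesis xy : y ^+ q + y = x ^+ M.
Hypothesis gen : forall z : F, exists f (d : {poly K}),
  d != 0 /\ z = eval2 iota x y f / eval2 iota x y d%:P.

Implicit Types (f : {poly {poly K}}) (d : {poly K}) (z : F) (P : place iota).

Local Notation ev := (eval2 iota x y).
Local Notation wt := (weight q M).
Local Notation leads := (leading q M).

Let q_gt0 : (0 < q)%N. Proof. exact: ltnW. Qed.

Lemma ev_polyC_neq0 d : d != 0 -> ev d%:P != 0.
Proof.
rewrite eval2_polyC => d0; apply/eqP => xd; apply: x_tr; exists d => //.
exact/eqP.
Qed.

Definition infinite (P : place iota) := ~ place_ring P x.

(** Of valuation 1 at infinity: x and y have valuations -q and -M = -(q s + 1). *)
Definition local_param : F := x ^+ s / y.
Local Notation t := local_param.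

Section AtInfinity.
Variable P : place iota.
Hypothesis Pinf : infinite P.

Lemma infinite_x : place_ideal P x^-1.
Proof. by apply/place_idealP; right; rewrite invrK. Qed.

Let x0 : x != 0.
Proof. by apply/eqP => x0; apply: Pinf; rewrite x0; apply: place_ring0. Qed.

Lemma infinite_y : place_ideal P y^-1.
Proof.
apply/place_idealP; right; rewrite invrK => Py.
apply: (@place_ideal1 _ _ _ P).
have M0 : (0 < M)%N by rewrite M_def addn1.
have := place_idealM (place_idealX infinite_x M0) (place_ringD (place_ringX q Py) Py).
by rewrite xy -exprMn mulVf // expr1n.
Qed.

Let y0 : y != 0.
Proof.
apply/eqP => y0; have := xy; rewrite y0 expr0n gtn_eqF // addr0 => /esym/eqP.
by rewrite expf_eq0 (negPf x0) andbF.
Qed.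

Let u0 : F := 1 + y^-1 ^+ q.-1.

Let u0_unit : place_unit P u0.
Proof.
apply: place_unitD; first exact: place_unit1.
by apply: place_idealX infinite_y _; rewrite -subn1 subn_gt0.
Qed.

Let tqx : t ^+ q * x = u0.
Proof.
(* u0 is the ratio of x^M = y^q + y to its main term y^q. *)
have -> : u0 = (y ^+ q + y) / y ^+ q.
  rewrite mulrDl divff ?expf_neq0 //; congr (_ + _).
  by rewrite -{2}(prednK q_gt0) exprS invfM mulVKf // exprVn.
by rewrite xy M_def exprD expr1 expr_div_n -exprM mulnC; ring.
Qed.

Let tMy : t ^+ M * y = u0 ^+ s.
Proof.
rewrite -tqx [RHS]exprMn -exprM M_def exprD expr1 -mulrA.
by congr (_ * _); rewrite /local_param divfK.
Qed.

Lemma infinite_monomial i j : place_unit P (t ^+ wt i j * (x ^+ i * y ^+ j)).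
Proof.
rewrite /weight exprD mulrACA !exprM -!exprMn tqx tMy.
by apply: place_unitM; do ?apply: place_unitX.
Qed.

Lemma local_param_ideal : place_ideal P t.
Proof.
apply: place_ideal_exp q_gt0 _; have -> : t ^+ q = x^-1 * u0 by rewrite -tqx mulrC mulfK.
by apply: place_idealM; [apply: infinite_x | case: u0_unit].
Qed.

Lemma local_param_neq0 : t != 0.
Proof. by rewrite mulf_neq0 ?expf_neq0 ?invr_eq0. Qed.

(** Multiplied by t to the weight of the leading monomial, this monomial becomes a
    unit and all the others fall into the ideal. *)
Lemma infinite_leading f i0 j0 : leads f i0 j0 -> place_unit P (t ^+ wt i0 j0 * ev f).
Proof.
move=> [j0q c0 dom].
have [i0m j0n] := coef2_neq0 c0.
rewrite (eval2_coef2 _ _ _ (leqnn _) (size_coef_xsize f)) (bigD1 (Ordinal j0n, Ordinal i0m)) //=.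
rewrite mulrDr.
apply: place_unitD.
  by rewrite mulrCA; apply: place_unitM; [apply: place_unit_iota | apply: infinite_monomial].
rewrite big_distrr /=; apply: place_ideal_sum => -[j i] /= ne.
have [->|cij] := eqVneq f`_j`_i 0; first by rewrite rmorph0 mul0r mulr0; apply: place_ideal0.
have lt_w : (wt i j < wt i0 j0)%N.
  apply: dom => //; apply: contra ne => /eqP[e1 e2].
  by rewrite xpair_eqE -!val_eqE /= e1 e2 !eqxx.
rewrite -(subnK (ltnW lt_w)) exprD -mulrA; apply: place_idealM.
  by apply: place_idealX local_param_ideal _; rewrite subn_gt0.
rewrite mulrCA; apply: place_ringM; first exact: place_ring_iota.
by case: (infinite_monomial i j).
Qed.

Lemma infinite_leading_val f i0 j0 : leads f i0 j0 ->
  place_unit P (ev f / t ^ (- (wt i0 j0)%:Z)).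
Proof. by rewrite -invr_expz invrK mulrC => /infinite_leading. Qed.

End AtInfinity.

(** Since x is transcendental, it is not a polynomial in 1 / x, so a place extends
    the ring of these polynomials with 1 / x in its ideal. *)
Lemma infinite_place_exists : exists P, infinite P.
Proof.
pose S : set F := [set z | exists p : {poly K}, z = (map_poly iota p).[x^-1]]%classic.
have subS : GRing.subring_closed (mem S).
  apply: subring_closed_set => [|_ _ [p ->] [r ->]|_ _ [p ->] [r ->]].
  - by exists 1; rewrite rmorph1 hornerC.
  - by exists (p - r); rewrite rmorphB hornerD hornerN.
  - by exists (p * r); rewrite rmorphM hornerM.
have iS : (range iota `<=` S)%classic.
  by move=> _ [c _ <-]; exists c%:P; rewrite map_polyC hornerC.
have Sx : S x^-1 by exists 'X; rewrite map_polyX hornerX.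
have x0 : x != 0.
  by apply/eqP => x0; apply: x_tr; rewrite x0; exists 'X; rewrite ?polyX_eq0 // map_polyX rootX.
have nSx : ~ S (x^-1)^-1.
  rewrite invrK => -[p xp]; apply: x_tr.
  (* If x = p(1 / x), clearing denominators gives an equation for x over K. *)
  pose n := size p; pose r := 'X^(n.+1) - \sum_(i < n) p`_i *: 'X^(n - i).
  exists r.
    apply/eqP => /(congr1 (fun p : {poly K} => p`_n.+1)) /eqP.
    rewrite coefB coefXn eqxx coef_sum big1 ?subr0 ?coef0 ?oner_eq0 // => i _.
    by rewrite coefZ coefXn gtn_eqF ?mulr0 // ltnS leq_subr.
  apply/rootP; rewrite rmorphB /= map_polyXn rmorph_sum /= hornerD hornerN hornerXn horner_sum.
  apply/eqP; rewrite subr_eq0; apply/eqP.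
  have /(congr1 ( *%R (x ^+ n))) := xp; rewrite -exprSr => ->.
  rewrite (horner_coef_wide (n := n)); last by rewrite size_map_poly.
  rewrite big_distrr /=; apply: eq_bigr => i _.
  rewrite coef_map map_polyZ map_polyXn hornerZ hornerXn mulrCA exprVn; congr (_ * _).
  by rewrite expfB_cond // (negPf x0) (ltnW (ltn_ord i)).
have [P _ Px] := place_extension subS iS Sx nSx.
by exists P; move: Px => /place_idealP[/eqP|]; rewrite ?invr_eq0 ?(negPf x0) ?invrK.
Qed.

Lemma ev_leading_neq0 f i0 j0 : leads f i0 j0 -> ev f != 0.
Proof.
move=> lf; have [P Pinf] := infinite_place_exists.
have [+ _ _] := infinite_leading Pinf lf.
by rewrite mulf_eq0 => /norP[].
Qed.

(** The linear independence of 1, y, ..., y^(q-1) over K(x). *)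
Lemma ev_reduced_neq0 f : f != 0 -> (size f <= q)%N -> ev f != 0.
Proof.
by move=> f0 sf; have [i0 [j0 /ev_leading_neq0]] := leading_exists M_def f0 sf.
Qed.

Lemma ev_eq0_curve f : ev f = 0 -> curve_mod q M f = 0.
Proof.
move=> f0; apply: contraTeq (eqxx (0 : F)) => r0.
by rewrite -{1}f0 -(eval2_curve_mod q_gt1 _ _ xy) ev_reduced_neq0 ?size_curve_mod.
Qed.

(** Makes the evaluation at a point of the curve well defined on K[x, y]. *)
Lemma ev_eq0_point (R : fieldType) (j : {rmorphism K -> R}) a b f :
  b ^+ q + b = a ^+ M -> ev f = 0 -> eval2 j a b f = 0.
Proof.
move=> ab /ev_eq0_curve r0.
by rewrite -(eval2_curve_mod q_gt1 _ _ ab) r0 rmorph0.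
Qed.

(** The exponent m is read off a fraction of polynomials, independently of the
    place; this is what makes the place at infinity unique. *)
Lemma infinite_value z : z != 0 ->
  exists m : int, forall P, infinite P -> place_unit P (z / t ^ m).
Proof.
have [f [d [d0 ->]]] := gen z; rewrite mulf_eq0 => /norP[f0 _].
pose r := curve_mod q M f.
have rf : ev r = ev f by apply: eval2_curve_mod.
have r0 : r != 0 by apply: contraNneq f0 => r0; rewrite -rf r0 rmorph0.
have [i [j lr]] := leading_exists M_def r0 (size_curve_mod _ q_gt1 f).
have [i' [j' ld]] : exists i' j', leads d%:P i' j'.
  by apply: (leading_exists M_def); rewrite ?polyC_eq0 // size_polyC d0.
exists ((wt i' j')%:Z - (wt i j)%:Z) => P Pinf.
have Ur := infinite_leading_val Pinf lr; have Ud := infinite_leading_val Pinf ld.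
have t0 := local_param_neq0 Pinf.
have -> : ev f / ev d%:P / t ^ ((wt i' j')%:Z - (wt i j)%:Z) =
    ev r / t ^ (- (wt i j)%:Z) / (ev d%:P / t ^ (- (wt i' j')%:Z)).
  rewrite rf expfzDr // -!invr_expz; move: (ev d%:P) (ev_polyC_neq0 d0) => e e0; field.
  by rewrite e0 oner_eq0 !expfz_neq0.
exact/place_unitM/place_unitV.
Qed.

Lemma infinite_prime_element P : infinite P -> prime_element P t.
Proof.
move=> Pinf; have t0 := local_param_neq0 Pinf; have Pt := local_param_ideal Pinf.
apply/seteqP; split=> z; last by move=> [u Pu <-]; apply: place_idealM.
move=> Pz; have [z0|z0] := eqVneq z 0.
  by exists 0; [apply: place_ring0 | rewrite mulr0].
have [m /(_ _ Pinf)] := infinite_value z0.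
case: m => [[|n]|n].
- by rewrite expr0z divr1 => /place_unit_ideal.
- move=> [_ Pu _]; exists (t ^+ n * (z / t ^+ n.+1)).
    by apply: place_ringM => //; apply/place_ringX/place_ideal_ring.
  by rewrite mulrA -exprS mulrC divfK ?expf_neq0.
- rewrite NegzE -invr_expz invrK => /place_unit_ideal; case.
  by apply: place_idealM => //; apply/place_ringX/place_ideal_ring.
Qed.

Lemma infinite_unique P P' : infinite P -> infinite P' -> P = P'.
Proof.
have sub P1 P2 : infinite P1 -> infinite P2 -> (place_ring P1 `<=` place_ring P2)%classic.
  move=> i1 i2 z Pz; have [->|z0] := eqVneq z 0; first exact: place_ring0.
  have t0 := local_param_neq0 i1.
  have [m Um] := infinite_value z0.
  have zE : z = t ^ m * (z / t ^ m) by rewrite mulrC divfK ?expfz_neq0.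
  rewrite zE; apply/(unit_exp_ring (infinite_prime_element i2) _ (Um _ i2)).
  by apply/(unit_exp_ring (infinite_prime_element i1) _ (Um _ i1)); rewrite -zE.
by move=> i1 i2; apply: place_inj; apply/seteqP; split; apply: sub.
Qed.

Lemma infinite_valuation P f i0 j0 : infinite P -> leads f i0 j0 ->
  valuation P (ev f) = - (wt i0 j0)%:Z.
Proof.
move=> Pinf lf; have t0 := local_param_neq0 Pinf.
have := valuationE (infinite_prime_element Pinf) (- (wt i0 j0)%:Z)
          (infinite_leading_val Pinf lf).
by rewrite mulrC divfK // expfz_neq0.
Qed.

(** Additivity of the valuation at infinity. *)
Lemma weight_product f g h i j i' j' k l :
  leads f i j -> leads g i' j' -> leads h k l -> ev f * ev g = ev h ->
  (wt i j + wt i' j' = wt k l)%N.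
Proof.
move=> lf lg lh e; have [P Pinf] := infinite_place_exists.
have t0 := local_param_neq0 Pinf; have tP := infinite_prime_element Pinf.
have Uf := infinite_leading_val Pinf lf; have Ug := infinite_leading_val Pinf lg.
have := valuationE tP (- (wt i j + wt i' j')%:Z) (place_unitM Uf Ug).
have -> : t ^ (- (wt i j + wt i' j')%:Z) *
    (ev f / t ^ (- (wt i j)%:Z) * (ev g / t ^ (- (wt i' j')%:Z))) = ev h.
  rewrite -e PoszD opprD expfzDr //.
  have := expfz_neq0 (- (wt i j)%:Z) t0; have := expfz_neq0 (- (wt i' j')%:Z) t0.
  by move: (t ^ _) (t ^ _) (ev f) (ev g) => a b c d a0 b0; field; rewrite a0 b0.
by rewrite (infinite_valuation Pinf lh) => /oppr_inj [].
Qed.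

End Infinity.

(** * The place of a smooth point *)

Section SmoothPoint.
Variables (K F E : fieldType) (iota : {rmorphism K -> F}) (B : comNzRingType).
Variables (c : {rmorphism K -> B}) (ev : {rmorphism B -> F}) (phi : {rmorphism B -> E}) (pi : B).
Hypothesis ev_c : forall k, ev (c k) = iota k.
Hypothesis ker_ev : forall f, ev f = 0 -> phi f = 0.
Hypothesis frac : forall z, exists f g, ev g != 0 /\ z = ev f / ev g.
Hypotheses (pi_neq0 : ev pi != 0) (phi_pi : phi pi = 0).
Hypothesis pi_generates : forall f, phi f = 0 ->
  exists u g, phi u != 0 /\ ev (u * f) = ev (pi * g).
Hypothesis pi_bounded : forall f, ev f != 0 ->
  exists f' m u, phi u != 0 /\ ev (f * f') = ev (pi ^+ m * u).

Let ev_neq0 g : phi g != 0 -> ev g != 0.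
Proof. by apply: contra_neq; apply: ker_ev. Qed.

(** The local ring at the point: quotients whose denominator does not vanish there.
    Here B stands for a ring of polynomials, [ev] for its map to the function field
    and [phi] for the evaluation at the point; pi generates the maximal ideal of
    the local ring. *)
Definition point_ring : set F :=
  [set z | exists f g, phi g != 0 /\ z = ev f / ev g].

(** Divide by pi as long as the value at the point is 0. The exponent m in
    [pi_bounded], for a multiple of f, bounds the number of divisions. *)
Lemma point_order f : ev f != 0 ->
  exists m u v, [/\ phi u != 0, phi v != 0 & ev (u * f) = ev (pi ^+ m * v)].
Proof.
move=> f0; have [f' [m [w [w0 e]]]] := pi_bounded f0.
elim: m f w w0 e {f0} => [|m IH] f w w0 e.
  exists 0, 1, f; split; rewrite ?rmorph1 ?oner_eq0 ?expr0 //.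
  apply/eqP => f0; move/eqP: w0; apply.
  have : ev (f * f' - w) = 0 by rewrite rmorphB e expr0 mul1r subrr.
  by move/ker_ev/eqP; rewrite rmorphB rmorphM /= f0 mul0r sub0r oppr_eq0 => /eqP.
have [f0|f0] := eqVneq (phi f) 0; last first.
  by exists 0, 1, f; split; rewrite ?rmorph1 ?oner_eq0 ?expr0.
have [u [g [u0 ug]]] := pi_generates f0.
have [||m' [u' [v [u'0 v0 e']]]] := IH g (u * w).
- by rewrite rmorphM mulf_neq0.
- apply: (mulfI pi_neq0); rewrite -!rmorphM /= mulrA rmorphM -ug -rmorphM /=.
  by rewrite -mulrA rmorphM e -rmorphM /= exprS; congr (ev _); ring.
exists m'.+1, (u' * u), v; split=> //; first by rewrite rmorphM mulf_neq0.
rewrite -mulrA rmorphM ug -rmorphM mulrCA [LHS]rmorphM e' -rmorphM /= exprS.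
by rewrite mulrA.
Qed.

Lemma point_normal_form z : z != 0 -> exists (m : int) u v,
  [/\ phi u != 0, phi v != 0 & z = ev pi ^ m * (ev u / ev v)].
Proof.
have [f [g [g0 ->]]] := frac z; rewrite mulf_eq0 => /norP[f0 _].
have [m [u [v [u0 v0 e]]]] := point_order f0.
have [m' [u' [v' [u'0 v'0 e']]]] := point_order g0.
exists (m%:Z - m'%:Z), (v * u'), (u * v'); split; rewrite ?rmorphM ?mulf_neq0 //.
have fE : ev f = ev pi ^+ m * ev v / ev u.
  by rewrite -rmorphXn -rmorphM -e rmorphM mulrC mulKf ?ev_neq0.
have gE : ev g = ev pi ^+ m' * ev v' / ev u'.
  by rewrite -rmorphXn -rmorphM -e' rmorphM mulrC mulKf ?ev_neq0.
rewrite fE gE expfzDr // -invr_expz -!exprnP.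
have := expf_neq0 m' pi_neq0; have := ev_neq0 u'0; have := ev_neq0 u0; have := ev_neq0 v'0.
move: (_ ^+ m') (_ ^+ m) (ev u) (ev u') (ev v) (ev v') => a1 a2 a3 a4 a5 a6 n1 n2 n3 n4.
by field; rewrite n1 n2 n3 n4.
Qed.

Lemma inv_pi_notin_point_ring : ~ point_ring (ev pi)^-1.
Proof.
move=> [f [g [g0 e]]]; have g1 := ev_neq0 g0; move/eqP: g0; apply.
have : ev (g - pi * f) = 0.
  have e2 : ev f = ev g / ev pi by rewrite e mulrC divfK.
  by rewrite rmorphB rmorphM e2 mulrC divfK // subrr.
by move/ker_ev; rewrite rmorphB rmorphM /= phi_pi mul0r subr0.
Qed.

Lemma point_valuation_ring : valuation_ring iota point_ring.
Proof.
split.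
- apply: subring_closed_set.
  + by exists 1, 1; rewrite !rmorph1 oner_eq0 divr1.
  + move=> _ _ [f [g [g0 ->]]] [f' [g' [g'0 ->]]].
    exists (f * g' - f' * g), (g * g'); rewrite !rmorphM mulf_neq0 // rmorphB !rmorphM.
    by split=> //; have := ev_neq0 g'0; have := ev_neq0 g0;
       move: (ev g) (ev g') (ev f) (ev f') => a1 a2 a3 a4 n1 n2; field; rewrite n1 n2.
  + move=> _ _ [f [g [g0 ->]]] [f' [g' [g'0 ->]]].
    exists (f * f'), (g * g'); rewrite !rmorphM mulf_neq0 //; split=> //.
    by rewrite invfM mulrACA.
- split=> [_ [k _ <-]|sub].
    by exists (c k), 1; rewrite !rmorph1 oner_eq0 divr1 ev_c.
  have [k _ e] : range iota (ev pi).
    by apply: sub; exists pi, 1; rewrite !rmorph1 oner_eq0 divr1.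
  apply: inv_pi_notin_point_ring; rewrite -e -fmorphV -ev_c.
  by exists (c k^-1), 1; rewrite !rmorph1 oner_eq0 divr1.
- by split=> // sub; apply: inv_pi_notin_point_ring; apply: sub.
- move=> z; have [->|z0] := eqVneq z 0.
    by left; exists 0, 1; rewrite !rmorph1 rmorph0 mul0r oner_eq0.
  have [m [u [v [u0 v0 ->]]]] := point_normal_form z0.
  case: m => m; [left; exists (pi ^+ m * u), v | right; exists (pi ^+ m.+1 * v), u];
    split=> //; rewrite rmorphM rmorphXn.
    by rewrite mulrA.
  by rewrite !invfM invrK NegzE -invr_expz invrK -exprnP -mulrA [_^-1 * _]mulrC.
Qed.

Definition point_place : place iota := Place point_valuation_ring.

Lemma point_place_ev f : place_ring point_place (ev f).
Proof. by exists f, 1; rewrite !rmorph1 oner_eq0 divr1. Qed.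

Lemma point_unit u v : phi u != 0 -> phi v != 0 -> place_unit point_place (ev u / ev v).
Proof.
move=> u0 v0; split; first by rewrite mulf_neq0 ?invr_eq0 ?ev_neq0.
  by exists u, v.
by exists v, u; rewrite invf_div.
Qed.

Lemma point_ideal f g : phi g != 0 -> place_ideal point_place (ev f / ev g) <-> phi f = 0.
Proof.
move=> g0; split=> [Pfg|f0].
  apply/eqP; apply: contraPT Pfg => f0.
  exact/place_unit_ideal/point_unit.
split; first by exists f, g.
move=> [z0 _ [h [k [k0 e]]]]; have := mulf_neq0 g0 k0; rewrite -rmorphM.
have e2 : ev (g * k - h * f) = 0.
  have := e; rewrite invf_div rmorphB !rmorphM => /(canRL (divfK _)) => ->; last first.
    by move: z0; rewrite mulf_eq0 => /norP[].
  by have := ev_neq0 k0; move: (ev k) (ev h) (ev f) => a1 a2 a3 n1; field.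
by have /eqP := ker_ev e2; rewrite rmorphB (rmorphM _ h) f0 mulr0 subr0 => ->.
Qed.

Lemma point_ideal_ev f : place_ideal point_place (ev f) <-> phi f = 0.
Proof.
have -> : ev f = ev f / ev 1 by rewrite rmorph1 divr1.
by apply: point_ideal; rewrite rmorph1 oner_eq0.
Qed.

Lemma point_prime_element : prime_element point_place (ev pi).
Proof.
apply/seteqP; split=> z; last first.
  by move=> [u Pu <-]; apply: place_idealM => //; apply/point_ideal_ev.
move=> Pz; have [f [g [g0 zE]]] := place_ideal_ring Pz.
move: Pz; rewrite zE => /point_ideal -/(_ g0) /pi_generates[u [h [u0 e]]].
exists (ev h / ev (u * g)).
  by exists h, (u * g); rewrite rmorphM mulf_neq0.
rewrite mulrA -rmorphM -e !rmorphM.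
have := ev_neq0 g0; have := ev_neq0 u0.
by move: (ev u) (ev f) (ev g) => a1 a2 a3 n1 n2; field; rewrite n1 n2.
Qed.

Lemma point_valuation_ge0 z : 0 <= valuation point_place z -> place_ring point_place z.
Proof.
have [->|z0] := eqVneq z 0; first by move=> _; apply: place_ring0.
have [m [u [v [u0 v0 ->]]]] := point_normal_form z0.
rewrite (valuationE point_prime_element _ (point_unit u0 v0)) => m0.
by apply/(unit_exp_ring point_prime_element _ (point_unit u0 v0)).
Qed.

Lemma point_residue f g k : phi g != 0 ->
  place_ideal point_place (ev f / ev g - iota k) <-> phi f = phi (c k) * phi g.
Proof.
move=> g0; have -> : ev f / ev g - iota k = ev (f - c k * g) / ev g.
  by rewrite rmorphB rmorphM ev_c mulrBl mulfK ?ev_neq0.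
rewrite point_ideal // rmorphB rmorphM.
by split=> [/eqP|->]; rewrite ?subrr // subr_eq0 => /eqP.
Qed.

Let phi_c_inj : injective (phi \o c). Proof. exact: fmorph_inj. Qed.

(** The residue field is the field of values at the point. *)
Lemma point_rational : (forall e : E, exists k, phi (c k) = e) -> rational_place point_place.
Proof.
move=> phi_c_surj; exists (fun=> 1); first by move=> _; apply: place_ring1.
move=> z [f [g [g0 ->]]]; have [k ek] := phi_c_surj (phi f / phi g).
have kE : phi f = phi (c k) * phi g by rewrite ek divfK.
exists [ffun=> k]; split.
  by rewrite big_ord1 ffunE mulr1; apply/point_residue.
move=> d; rewrite big_ord1 mulr1 => /(point_residue _ _ g0) kE'.
apply/ffunP => i; rewrite ffunE ord1; apply: phi_c_inj => /=.
by apply: (mulIf g0); rewrite -kE'.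
Qed.

Lemma point_eval f k : phi f = phi (c k) -> place_eval point_place (ev f) = k.
Proof.
have res l : place_ideal point_place (ev f - iota l) <-> phi f = phi (c l).
  have -> : ev f - iota l = ev f / ev 1 - iota l by rewrite rmorph1 divr1.
  by rewrite point_residue rmorph1 ?oner_eq0 // mulr1.
move=> fk; apply: xget_unique; first exact/res.
by move=> l /res; rewrite fk => /phi_c_inj.
Qed.

End SmoothPoint.

(** * Finite places of the curve, and regular functions *)

Section PolyFacts.
Variable K : fieldType.
Implicit Types p d : {poly K}.

Lemma poly_multiplicity p d : (1 < size p)%N -> d != 0 ->
  exists m d', d = p ^+ m * d' /\ ~~ (p %| d').
Proof.
move=> sp; have [n] := ubnP (size d); elim: n d => // n IH d sd d0.
have [pd|npd] := boolP (p %| d); last by exists 0, d; rewrite expr0 mul1r.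
have dE := divpK pd; have e0 : d %/ p != 0.
  by apply: contraNneq d0 => e0; rewrite -dE e0 mul0r.
have p0 : p != 0 by rewrite -size_poly_eq0 -lt0n (ltnW sp).
have [|m [d' [e nd']]] := IH (d %/ p) _ e0.
  rewrite -dE in sd; move: sd; rewrite size_mul // ltnS.
  by move: e0 sp; rewrite -size_poly_eq0; move: (size _) (size _) => a b; lia.
by exists m.+1, d'; split=> //; rewrite -dE e exprSr; ring.
Qed.

Lemma irreducible_factor d : (1 < size d)%N -> exists2 p, irreducible_poly p & p %| d.
Proof.
have [n] := ubnP (size d); elim: n d => // n IH d sd d1.
have [irr|nirr] := pselect (irreducible_poly d); first by exists d.
have [p [sp pd npd]] : exists p, [/\ size p != 1%N, p %| d & ~~ (p %= d)].
  apply: contrapT => H; apply: nirr; split=> // p sp pd.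
  by apply/negPn/negP => npd; apply: H; exists p.
have d0 : d != 0 by rewrite -size_poly_gt0 (ltnW d1).
have p0 : p != 0 by apply: dvdpN0 pd d0.
have ltp : (size p < size d)%N.
  by rewrite ltn_neqAle dvdp_leq // andbT dvdp_size_eqp.
have [||r ir rp] := IH p; last by exists r => //; apply: dvdp_trans pd.
  by rewrite (leq_trans ltp).
by move: sp p0; rewrite -size_poly_eq0; case: (size p) => [|[]].
Qed.

Lemma irreducible_root_dvdp (E : fieldType) (j : {rmorphism K -> E}) p d a :
  irreducible_poly p -> root (map_poly j p) a -> ((map_poly j d).[a] == 0) = (p %| d).
Proof.
move=> [sp irr] pa; apply/idP/idP => [da|/dvdpP[r ->]]; last first.
  by rewrite rmorphM hornerM (eqP pa) mulr0.
have [|] := boolP (coprimep p d).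
  rewrite -(coprimep_map j) => /coprimep_root -/(_ _ pa).
  by rewrite da.
rewrite /coprimep => sg; have := irr _ sg (dvdp_gcdl p d).
by move=> /eqp_dvdl <-; apply: dvdp_gcdr.
Qed.

End PolyFacts.

(** A finite-dimensional extension of a finite field is again finite. *)
Lemma finite_extension_root (E : finFieldType) (p : {poly E}) : (1 < size p)%N ->
  exists (E' : finFieldType) (j : {rmorphism E -> E'}) a, root (map_poly j p) a.
Proof.
move=> /irreducible_factor[r ir rp].
have [L _ [z rz _]] := irredp_FAdjoin ir.
pose E' : finFieldType := finvect_type L.
exists E', (GRing.in_alg L : {rmorphism E -> L}), z.
have /dvdpP[w ->] := rp.
by rewrite rmorphM /= rootM rz orbT.
Qed.

Section CurvePoints.
Variables (K F : fieldType) (iota : {rmorphism K -> F}) (q s M : nat) (x y : F).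
Hypotheses (q_gt1 : (1 < q)%N) (M_def : M = (q * s + 1)%N).
Hypothesis x_tr : ~ algebraicOver iota x.
Hypothesis xy : y ^+ q + y = x ^+ M.
Hypothesis gen : forall z : F, exists f (d : {poly K}),
  d != 0 /\ z = eval2 iota x y f / eval2 iota x y d%:P.
Hypothesis q_pchar : [pchar K].-nat q.
Variable Gamma : seq K.
Hypotheses (Gamma_uniq : uniq Gamma) (Gamma_size : size Gamma = q).
Hypothesis Gamma_root : forall g, g \in Gamma -> g ^+ q + g = 0.

Implicit Types (f r : {poly {poly K}}) (d : {poly K}) (z : F).
Local Notation ev := (eval2 iota x y).

Section Fibre.
Variables (E : fieldType) (j : {rmorphism K -> E}) (a b : E) (p : {poly K}) (N : nat).
Hypotheses (N_gt0 : (0 < N)%N) (N_exp : forall e : E, e ^+ N.+1 = e).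
Hypothesis ab : b ^+ q + b = a ^+ M.
Hypothesis p_neq0 : p != 0.
Hypothesis p_min : forall d, ((map_poly j d).[a] == 0) = (p %| d).

(** Translations of y by the roots g of g^q + g = 0 are automorphisms of the curve
    over the x-line. *)
Lemma fibre_on_curve g : g \in Gamma -> (b + j g) ^+ q + (b + j g) = a ^+ M.
Proof.
move=> /Gamma_root g0; rewrite exprDn_pchar; last first.
  by rewrite (eq_pnat _ (fmorph_pchar j)).
by rewrite addrACA ab -rmorphXn -rmorphD g0 rmorph0 addr0.
Qed.

(** A polynomial in y of degree less than q with q roots is zero; its coefficients,
    polynomials in x, thus vanish at a and are divisible by p. *)
Lemma fibre_vanish r : (size r <= q)%N ->
  (forall g, g \in Gamma -> eval2 j a (b + j g) r = 0) -> exists r', r = p%:P * r'.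
Proof.
move=> sr van.
suff H : map_poly (horner_eval a \o map_poly j) r = 0.
  have pr i : p %| r`_i.
    rewrite -p_min; apply/eqP.
    by have /(congr1 (fun P : {poly E} => P`_i)) := H; rewrite coef_map coef0.
  exists (\poly_(i < size r) (r`_i %/ p)); apply/polyP => i.
  rewrite coefCM coef_poly; case: ltnP => [_|si]; last by rewrite mulr0 nth_default.
  by rewrite mulrC divpK.
apply: (roots_geq_poly_eq0 (rs := [seq b + j g | g <- Gamma])).
- by apply/allP => _ /mapP[g gG ->]; apply/eqP/van.
- by rewrite map_inj_uniq // => g g' /addrI /fmorph_inj.
- by rewrite size_map Gamma_size (leq_trans (size_poly _ _)).
Qed.

Local Notation phi := (eval2 j a b).

(** The multiplier u = 1 - f^N is 1 at the point, and vanishes at each point of the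
    fibre where f does not, since e^N = 1 for every nonzero e in E. So u f vanishes on the
    whole fibre. *)
Lemma fibre_generates f : phi f = 0 ->
  exists u g, phi u != 0 /\ ev (u * f) = ev (p%:P * g).
Proof.
move=> f0.
have phi_u g : eval2 j a g (1 - f ^+ N) = 1 - eval2 j a g f ^+ N.
  by rewrite eval2B eval2_1 eval2Xn.
have [|r' er] := @fibre_vanish (curve_mod q M ((1 - f ^+ N) * f)) (size_curve_mod _ q_gt1 _).
  move=> g /fibre_on_curve gab; rewrite eval2_curve_mod // eval2M phi_u.
  by rewrite mulrBl mul1r -exprSr N_exp subrr.
exists (1 - f ^+ N), r'; split; last by rewrite -er eval2_curve_mod.
by rewrite phi_u f0 expr0n gtn_eqF // subr0 oner_eq0.
Qed.

Let p_root : (map_poly j p).[a] = 0. Proof. by apply/eqP; rewrite p_min. Qed.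

Let size_p : (1 < size p)%N.
Proof.
rewrite ltnNge; apply/negP => s1; have e := size1_polyC s1.
have := p_root; rewrite e map_polyC hornerC => /eqP; rewrite fmorph_eq0 => /eqP p0.
by move: p_neq0; rewrite e p0 eqxx.
Qed.

(** f divides a nonzero polynomial d(x), namely the denominator of 1 / f, and the
    multiplicity of p in d bounds the order of f. *)
Lemma fibre_bounded f : ev f != 0 ->
  exists f' m u, phi u != 0 /\ ev (f * f') = ev (p%:P ^+ m * u).
Proof.
move=> f0; have [f' [d [d0 e]]] := gen (ev f)^-1.
have [m [d' [dE nd']]] := poly_multiplicity size_p d0.
exists f', m, d'%:P; split; first by rewrite eval2_polyC p_min.
have ed := ev_polyC_neq0 y x_tr d0.
have ef' : ev f' = (ev f)^-1 * ev d%:P by rewrite e divfK.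
have -> : ev (f * f') = ev d%:P by rewrite eval2M ef' mulVKf.
by rewrite dE (rmorphM polyC) (rmorphXn polyC).
Qed.

Let B : comNzRingType := {poly {poly K}}.
Let cB : {rmorphism K -> B} := polyC \o polyC.
Let evB : {rmorphism B -> F} := ev.
Let phiB : {rmorphism B -> E} := phi.
Let piB : B := p%:P.

Let ev_c k : evB (cB k) = iota k. Proof. exact: eval2_const. Qed.
Let ker_ev f : evB f = 0 -> phiB f = 0.
Proof. exact: (ev_eq0_point q_gt1 M_def x_tr xy). Qed.
Let frac z : exists f g, evB g != 0 /\ z = evB f / evB g.
Proof. by have [f [d [d0 ->]]] := gen z; exists f, d%:P; rewrite ev_polyC_neq0. Qed.
Let ev_p : evB piB != 0. Proof. exact: ev_polyC_neq0. Qed.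
Let phi_p : phiB piB = 0. Proof. by rewrite [LHS]eval2_polyC. Qed.
Let gens (f : B) : phiB f = 0 ->
  exists u g, phiB u != 0 /\ evB (u * f) = evB (piB * g).
Proof. exact: fibre_generates. Qed.
Let bound (f : B) : evB f != 0 ->
  exists f' m u, phiB u != 0 /\ evB (f * f') = evB (piB ^+ m * u).
Proof. exact: fibre_bounded. Qed.

Definition curve_place : place iota :=
  point_place ev_c ker_ev frac ev_p phi_p gens bound.

Lemma curve_place_ev f : place_ring curve_place (ev f).
Proof. exact: point_place_ev. Qed.

Lemma curve_place_finite : ~ infinite x curve_place.
Proof. by apply; have := curve_place_ev 'X%:P; rewrite eval2_X. Qed.

Lemma curve_ideal_ev f : place_ideal curve_place (ev f) <-> phi f = 0.
Proof. exact: point_ideal_ev. Qed.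

Lemma curve_valuation_ge0 z : 0 <= valuation curve_place z -> place_ring curve_place z.
Proof. exact: point_valuation_ge0. Qed.

Lemma curve_place_rational : (forall e : E, exists k, j k = e) -> rational_place curve_place.
Proof.
move=> j_surj; apply: point_rational => e; have [k <-] := j_surj e; exists k.
exact: eval2_const.
Qed.

Lemma curve_place_eval f k : phi f = j k -> place_eval curve_place (ev f) = k.
Proof. by move=> e; apply: point_eval; rewrite [LHS]e [RHS]eval2_const. Qed.

End Fibre.
End CurvePoints.

Section Regular.
Variables (K : finFieldType) (F : fieldType) (iota : {rmorphism K -> F}).
Variables (q s M : nat) (x y : F).
Hypotheses (q_gt1 : (1 < q)%N) (M_def : M = (q * s + 1)%N).
Hypothesis x_tr : ~ algebraicOver iota x.
Hypothesis xy : y ^+ q + y = x ^+ M.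
Hypothesis gen : forall z : F, exists f (d : {poly K}),
  d != 0 /\ z = eval2 iota x y f / eval2 iota x y d%:P.
Hypothesis q_pchar : [pchar K].-nat q.
Variable Gamma : seq K.
Hypotheses (Gamma_uniq : uniq Gamma) (Gamma_size : size Gamma = q).
Hypothesis Gamma_root : forall g, g \in Gamma -> g ^+ q + g = 0.

Local Notation ev := (eval2 iota x y).

Lemma finite_field_exp (E : finFieldType) :
  exists2 N, (0 < N)%N & forall e : E, e ^+ N.+1 = e.
Proof.
have E1 := finRing_gt1 E; exists #|E|.-1; first by rewrite -subn1 subn_gt0.
by move=> e; rewrite prednK ?expf_card // ltnW.
Qed.

Lemma point_over_irreducible (p : {poly K}) : irreducible_poly p ->
  exists (E : fieldType) (j : {rmorphism K -> E}) a b N,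
    [/\ (0 < N)%N, forall e : E, e ^+ N.+1 = e, b ^+ q + b = a ^+ M &
        root (map_poly j p) a].
Proof.
move=> [sp _]; have [E1 [j1 [a ra]]] := finite_extension_root sp.
pose h : {poly E1} := 'X^q + ('X - (a ^+ M)%:P).
have sh : (1 < size h)%N by rewrite size_polyDl size_polyXn ?size_XsubC // ltnS ltnW.
have [E2 [j2 [b rb]]] := finite_extension_root sh.
have [N N0 NE] := finite_field_exp E2.
exists E2, (j2 \o j1 : {rmorphism K -> E2}), (j2 a), b, N; split=> //.
- move: rb; rewrite /root /h rmorphD rmorphB /= map_polyXn map_polyX map_polyC.
  rewrite !(hornerD, hornerN, hornerXn, hornerX, hornerC) addrA subr_eq0 => /eqP ->.
  exact: rmorphXn.
- by rewrite map_poly_comp; apply: rmorph_root.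
Qed.

(** If an irreducible p divides the denominator d of z = f / d, then f = z d vanishes
    at all the points above a root of p, because z is regular there; by
    [fibre_vanish] the factor p cancels. *)
Lemma regular_polynomial z :
  (forall P : place iota, ~ infinite x P -> 0 <= valuation P z) -> exists f, z = ev f.
Proof.
move=> z_ge0; have [f [d [d0 zE]]] := gen z.
have [n] := ubnP (size d); elim: n f d d0 zE => // n IH f d d0 zE sd.
have [s1|s1] := leqP (size d) 1.
  exists (f * (d`_0)^-1%:P%:P).
  have d00 : d`_0 != 0 by move: d0; rewrite {1}(size1_polyC s1) polyC_eq0.
  rewrite eval2M zE {1}(size1_polyC s1) !eval2_const fmorphV //.
have [p ir pd] := irreducible_factor s1.
have [E [j [a [b [N [N0 NE ab ra]]]]]] := point_over_irreducible ir.
have p0 : p != 0 by apply: dvdpN0 pd d0.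
have p_min e : ((map_poly j e).[a] == 0) = (p %| e) by apply: irreducible_root_dvdp.
have edp : d = p * (d %/ p) by rewrite mulrC divpK.
have d'0 : d %/ p != 0 by apply: contraNneq d0 => e0; rewrite edp e0 mulr0.
have [||r' er] := @fibre_vanish K q Gamma Gamma_uniq Gamma_size E j a b p p_min
    (curve_mod q M f).
- exact: size_curve_mod.
- move=> g gG.
  have gab := fibre_on_curve q_pchar Gamma_root j ab gG.
  pose P := curve_place q_gt1 M_def x_tr xy gen q_pchar Gamma_uniq Gamma_size
    Gamma_root N0 NE gab p0 p_min.
  have Pz : place_ring P z.
    by apply: curve_valuation_ge0; apply: z_ge0; apply: curve_place_finite.
  rewrite eval2_curve_mod //; apply/(curve_ideal_ev q_gt1 M_def x_tr xy gen q_pchar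
    Gamma_uniq Gamma_size Gamma_root N0 NE gab p0 p_min).
  have -> : ev f = ev d%:P * z by rewrite zE mulrC divfK // ev_polyC_neq0.
  apply: place_idealM => //; apply/curve_ideal_ev.
  by rewrite eval2_polyC; apply/eqP; rewrite p_min.
have ed : ev d%:P = ev p%:P * ev (d %/ p)%:P by rewrite {1}edp polyCM eval2M.
apply: (IH r' (d %/ p) d'0).
  rewrite zE -(eval2_curve_mod q_gt1 _ _ xy) er ed eval2M.
  by rewrite -mulf_div divff ?mul1r // ev_polyC_neq0.
have sp : (1 < size p)%N by case: ir.
rewrite edp size_mul // in sd; move: sd d'0; rewrite -size_poly_eq0.
by move: (size _) (size _) sp => u v; lia.
Qed.

End Regular.

(** * The function field of the curve *)

Lemma fraction_quotient (R : idomainType) (c : {fraction R}) :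
  exists n d : R, d != 0 /\ c = FracField.tofrac n / FracField.tofrac d.
Proof.
elim/quotW: c => r; exists r.1, r.2; split; first exact: denom_ratioP.
have d0 := denom_ratioP r.
apply: (canRL (mulfK _)); first by rewrite tofrac_eq0.
unlock FracField.tofrac; rewrite -[LHS]FracField.pi_mul.
apply/eqP; rewrite FracField.equivf_def /FracField.mulf !numden_Ratio ?oner_eq0 ?mulf_neq0 //.
  by rewrite !mulr1 mulrC.
all: exact: oner_neq0.
Qed.

(** The field K(x)[y] modulo an irreducible factor of the equation. That the
    equation is itself irreducible follows from the existence of a place at infinity. *)
Lemma artin_schreier_field (K : fieldType) (q M : nat) : (1 < q)%N ->
  exists (F : fieldType) (iota : {rmorphism K -> F}) (x y : F),
    [/\ ~ algebraicOver iota x, y ^+ q + y = x ^+ M &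
        forall z, exists f (d : {poly K}),
          d != 0 /\ z = eval2 iota x y f / eval2 iota x y d%:P].
Proof.
move=> q_gt1; pose kx : fieldType := {fraction {poly K}}.
pose frac : {rmorphism {poly K} -> kx} := @FracField.tofrac {poly K}.
have frac_eq0 d : (frac d == 0) = (d == 0) by apply: tofrac_eq0.
have kxP (c : kx) : exists n d, d != 0 /\ c = frac n / frac d by apply: fraction_quotient.
pose h : {poly kx} := 'X^q + ('X - (frac 'X ^+ M)%:P).
have sh : (1 < size h)%N by rewrite size_polyDl size_polyXn ?size_XsubC // ltnS ltnW.
have [r ir rh] := irreducible_factor sh.
have [L _ [y ry genL]] := irredp_FAdjoin ir.
pose g : {rmorphism kx -> L} := GRing.in_alg L.
clearbody frac; pose iota : {rmorphism K -> L} := g \o (frac \o polyC).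
pose x : L := g (frac 'X).
have evx d : (map_poly iota d).[x] = g (frac d).
  rewrite /iota /x (map_poly_comp g) horner_map (map_poly_comp frac) horner_map.
  by congr (g (frac _)); apply: comp_polyXr.
have x_tr d : d != 0 -> g (frac d) != 0 by rewrite fmorph_eq0 frac_eq0.
exists L, iota, x, y; split.
- by move=> [d d0 /rootP]; rewrite evx => /eqP; apply/negP/x_tr.
- have /rootP : root (map_poly g h) y by have /dvdpP[w ->] := rh; rewrite rmorphM rootM ry orbT.
  rewrite /h rmorphD rmorphB /= map_polyXn map_polyX map_polyC.
  rewrite !(hornerD, hornerN, hornerXn, hornerX, hornerC) addrA => /eqP.
  by rewrite subr_eq0 => /eqP ->; apply: rmorphXn.
move=> z; have : z \in <<1; y>>%VS by rewrite genL memvf.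
move=> /Fadjoin_polyP[_ /polyOver1P[p ->] ->]; rewrite -[GRing.in_alg L]/(g : _ -> _).
elim/poly_ind: p => [|p c [f [d [d0 e]]]].
  by exists 0, 1; rewrite oner_neq0 eval2_0 mul0r rmorph0 horner0.
have [n [d' [d'0 cE]]] := kxP c.
have gc : g c = g (frac n) / g (frac d') by rewrite cE fmorph_div.
exists ('X * f * d'%:P + (n * d)%:P), (d * d'); split; first by rewrite mulf_neq0.
have -> : (map_poly g (p * 'X + c%:P)).[y] = (map_poly g p).[y] * y + g c.
  by rewrite rmorphD rmorphM hornerD hornerM /= map_polyX map_polyC hornerX hornerC.
rewrite e gc.
rewrite eval2D !eval2M !eval2_polyC eval2_Y !evx !rmorphM.
have := x_tr _ d0; have := x_tr _ d'0; move: (g (frac d)) (g (frac d')) => u v u0 v0.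
by field; rewrite u0 v0.
Qed.

(** * Counting solutions in K *)

Section RootCounts.
Variable K : finFieldType.

(** X^#|K| - X is the product of the X - a, a in K, so its divisors split with
    distinct roots. *)
Lemma card_split_roots (p : {poly K}) : p %| 'X^#|K| - 'X ->
  #|[pred a | root p a]| = (size p).-1.
Proof.
rewrite finField_genPoly => /dvdp_prod_XsubC[m pm].
have um : uniq (mask m (index_enum K)) by rewrite mask_uniq ?index_enum_uniq.
rewrite (eqp_size pm) size_prod_XsubC /= -(card_uniqP um).
by apply: eq_card => a; rewrite inE (eqp_root pm) root_prod_XsubC.
Qed.

Lemma card_unity_roots M : (0 < M)%N -> (M %| #|K|.-1)%N ->
  #|[pred a : K | a ^+ M == 1]| = M.
Proof.
move=> M0 /dvdnP[k kM].
have card : #|K|.-1.+1 = #|K| by rewrite prednK // ltnW ?finRing_gt1.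
have dvd : 'X^M - 1 %| 'X^#|K| - ('X : {poly K}).
  have -> : 'X^#|K| - 'X = ('X^M ^+ k - 1) * 'X :> {poly K}.
    by rewrite -exprM mulnC -kM mulrBl mul1r -exprSr card.
  by rewrite [X in _ %| X * _]subrX1 -mulrA dvdp_mulIl.
have := card_split_roots dvd; rewrite size_XnsubC //= => cM; rewrite -[RHS]cM.
by apply: eq_card => a; rewrite !inE -unity_rootE.
Qed.

End RootCounts.

Lemma exprBn_pchar (R : comNzRingType) (a b : R) N :
  [pchar R].-nat N -> (a - b) ^+ N = a ^+ N - b ^+ N.
Proof. by move=> chN; rewrite -[in RHS](subrK b a) [in RHS]exprDn_pchar // addrK. Qed.

Section ArtinSchreierRoots.
Variables (K : finFieldType) (q n : nat).
Hypotheses (q_pchar : [pchar K].-nat q) (n_odd : odd n) (cardK : #|K| = (q ^ (2 * n))%N).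

(** Modulo H = X^q + X - c one has X^(q^k) = s + (-1)^k X, where the constant s is
    fixed by the power q^n, like c. For n odd, X^(q^n) = s - X, and applying the
    power q^n once more gives X^(q^(2n)) = X. *)
Lemma artin_schreier_dvdp (c : K) : (0 < q)%N -> c ^+ (q ^ n) = c ->
  'X^q + ('X - c%:P) %| 'X^#|K| - 'X.
Proof.
move=> q0 cn; set H := 'X^q + _.
have chP k : [pchar {poly K}].-nat (q ^ k)%N.
  by rewrite pnatX (eq_pnat _ (pchar_poly K)) q_pchar.
have chK k : [pchar K].-nat (q ^ k)%N by rewrite pnatX q_pchar.
have HX k : H %| 'X^(q ^ k.+1) + 'X^(q ^ k) - (c ^+ (q ^ k))%:P.
  have -> : 'X^(q ^ k.+1) + 'X^(q ^ k) - (c ^+ (q ^ k))%:P = H ^+ (q ^ k).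
    by rewrite exprDn_pchar // exprBn_pchar // -exprM -expnS polyC_exp addrA.
  by rewrite -[X in X %| _]expr1 dvdp_exp2l // expn_gt0 q0.
have step k : exists2 s : K, s ^+ (q ^ n) = s &
    H %| 'X^(q ^ k) - (s%:P + (-1) ^+ k *: 'X).
  elim: k => [|k [s sn Hk]].
    exists 0; first by rewrite expr0n expn_eq0 (gtn_eqF q0).
    by rewrite expn0 expr0 scale1r add0r subrr dvdp0.
  exists (c ^+ (q ^ k) - s); first by rewrite exprBn_pchar // sn -exprM mulnC exprM cn.
  have := dvdp_sub (HX k) Hk; congr (_ %| _).
  by rewrite rmorphB /= exprS mulN1r scaleNr; ring.
have [s sn Hs] := step n.
pose T : {poly K} := 'X^(q ^ n) - (s%:P - 'X).
have {}Hs : H %| T by move: Hs; rewrite -signr_odd n_odd expr1 scaleN1r.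
have -> : 'X^#|K| - 'X = T ^+ (q ^ n) - T.
  rewrite /T exprBn_pchar // exprBn_pchar // -exprM -polyC_exp sn -expnD addnn -mul2n -cardK.
  by ring.
apply: dvdp_sub => //; apply: dvdp_trans Hs _.
by rewrite -[X in X %| _]expr1 dvdp_exp2l // expn_gt0 q0.
Qed.

Lemma card_artin_schreier (c : K) : (1 < q)%N -> c ^+ (q ^ n) = c ->
  #|[pred b : K | b ^+ q + b == c]| = q.
Proof.
move=> q1 cn; have := card_split_roots (artin_schreier_dvdp (ltnW q1) cn).
rewrite size_polyDl size_polyXn ?size_XsubC //= => cq; rewrite -[RHS]cq; apply: eq_card => b.
by rewrite !inE /root !(hornerD, hornerN, hornerXn, hornerX, hornerC) addrA subr_eq0.
Qed.

End ArtinSchreierRoots.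

(** * Zeros of a polynomial on the curve *)

Lemma extend_by_zero (K : fieldType) (T : finType) (A : {set T}) (v : 'I_#|A| -> K) :
  exists2 c : T -> K, forall t, c t != 0 -> t \in A & forall i, c (enum_val i) = v i.
Proof.
exists (fun t => \sum_(i < #|A| | enum_val i == t) v i).
  move=> t; apply: contraNT => tA; rewrite big1 // => i /eqP it.
  by rewrite -it enum_valP in tA.
move=> i; rewrite (bigD1 i) //= big1 ?addr0 // => k /andP[/eqP /enum_val_inj ->].
by rewrite eqxx.
Qed.

Lemma underdetermined_system (K : fieldType) (T1 T2 : finType)
    (A : {set T1}) (B : {set T2}) (e : T1 -> T2 -> K) : (#|B| < #|A|)%N ->
  exists c : T1 -> K, [/\ exists t, c t != 0, forall t, c t != 0 -> t \in A &
    forall u, u \in B -> \sum_t c t * e t u = 0].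
Proof.
move=> BA; pose X := \matrix_(i < #|A|, k < #|B|) e (enum_val i) (enum_val k).
have /rowV0Pn[v /sub_kermxP vX v0] : kermx X != 0.
  by rewrite kermx_eq0 /row_free neq_ltn (leq_ltn_trans (rank_leq_col X) BA).
have [c cA cv] := extend_by_zero (v 0).
exists c; split=> //.
  by have /rV0Pn[i vi] := v0; exists (enum_val i); rewrite cv.
move=> u uB; have := congr1 (fun Y : 'rV_ _ => Y 0 (enum_rank_in uB u)) vX.
rewrite !mxE => {2}<-.
transitivity (\sum_(t in A) c t * e t u).
  rewrite [RHS]big_mkcond; apply: eq_bigr => t _; case: ifPn => // tA.
  by have [->|/cA] := eqVneq (c t) 0; rewrite ?mul0r // (negPf tA).
rewrite big_enum_val; apply: eq_bigr => i _.
by rewrite cv mxE enum_rankK_in.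
Qed.

Section BoxPoly.
Variables (K : fieldType) (n m : nat).
Implicit Types (c : 'I_n * 'I_m -> K) (p : 'I_n * 'I_m).

(** The pair p of indices lists the degree in y first, then the degree in x. *)
Definition boxpoly c : {poly {poly K}} := \sum_p (c p *: 'X^(p.2))%:P * 'X^(p.1).

Lemma coef_boxpoly c (i j : nat) :
  (boxpoly c)`_j`_i = \sum_(p : 'I_n * 'I_m | (j == p.1 :> nat) && (i == p.2 :> nat)) c p.
Proof.
rewrite !coef_sum [RHS]big_mkcond; apply: eq_bigr => p _ /=.
rewrite coefCM coefXn; case: (j == p.1 :> nat); last by rewrite mulr0 coef0.
by rewrite mulr1 coefZ coefXn /=; case: (i == p.2 :> nat); rewrite ?mulr1 ?mulr0.
Qed.

Lemma coef_boxpoly_in c p : (boxpoly c)`_p.1`_p.2 = c p.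
Proof.
rewrite coef_boxpoly (bigD1 p) ?eqxx //= big1 ?addr0 // => r /andP[/andP[/eqP e1 /eqP e2]].
by case: p r e1 e2 => [p1 p2] [r1 r2] /= /val_inj <- /val_inj <-; rewrite eqxx.
Qed.

Lemma coef_boxpoly_neq0 c i j : (boxpoly c)`_j`_i != 0 ->
  exists2 p, (j, i) = (val p.1, val p.2) & c p != 0.
Proof.
move=> c0; have [p /andP[/eqP e1 /eqP e2]] :
    exists p : 'I_n * 'I_m, (j == p.1 :> nat) && (i == p.2 :> nat).
  apply/existsP; apply: contraNT c0; rewrite negb_exists => /forallP H.
  rewrite coef_boxpoly big1 // => p; by rewrite (negPf (H p)).
by exists p; [rewrite e1 e2 | rewrite -coef_boxpoly_in -e1 -e2].
Qed.

Lemma size_boxpoly c : (size (boxpoly c) <= n)%N.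
Proof.
apply/leq_sizeP => j nj; rewrite coef_sum big1 // => p _.
by rewrite coefCM coefXn gtn_eqF ?mulr0 // (leq_trans (ltn_ord p.1)).
Qed.

Lemma eval2_boxpoly (R : fieldType) (h : {rmorphism K -> R}) a b c :
  eval2 h a b (boxpoly c) = \sum_p h (c p) * (a ^+ p.2 * b ^+ p.1).
Proof.
rewrite /boxpoly (big_morph _ (eval2D h a b) (eval2_0 h a b)).
apply: eq_bigr => p _; rewrite eval2M eval2Xn eval2_Y eval2_polyC.
by rewrite map_polyZ map_polyXn hornerZ hornerXn mulrA.
Qed.

End BoxPoly.

Lemma card_ord_add n k : #|[set i : 'I_n | (i + k < n)%N]| = (n - k)%N.
Proof.
have -> : [set i : 'I_n | (i + k < n)%N] = [set i : 'I_n | (i < n - k)%N].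
  by apply/setP => i; rewrite !inE; lia.
rewrite cardsE -sum1_card (big_ord_narrow (leq_subr k n)) /=.
by rewrite sum1_card card_ord.
Qed.

Lemma leading_polyC (K : fieldType) q M (d : {poly K}) : (0 < q)%N -> d != 0 ->
  leading q M d%:P (size d).-1 0.
Proof.
move=> q0 d0; split=> //; first by rewrite coefC -lead_coefE lead_coef_eq0.
move=> i j; rewrite coefC; case: (j =P 0%N) => [->|_]; last by rewrite coef0 eqxx.
move=> ci; rewrite xpair_eqE eqxx andbT => ne.
rewrite /weight !muln0 !addn0 ltn_pmul2l // ltn_neqAle ne /= -ltnS prednK ?size_poly_gt0 //.
by rewrite ltnNge; apply: contra ci => H; rewrite nth_default.
Qed.

Section ZeroBound.
Variables (K : finFieldType) (F : fieldType) (iota : {rmorphism K -> F}).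
Variables (q s M : nat) (x y : F).
Hypotheses (q_gt1 : (1 < q)%N) (M_def : M = (q * s + 1)%N).
Hypothesis x_tr : ~ algebraicOver iota x.
Hypothesis xy : y ^+ q + y = x ^+ M.
Hypothesis gen : forall z : F, exists f (d : {poly K}),
  d != 0 /\ z = eval2 iota x y f / eval2 iota x y d%:P.
Hypothesis fibre_card : forall a : K, #|[pred b : K | b ^+ q + b == a ^+ M]| = q.

Local Notation ev := (eval2 iota x y).
Local Notation wt := (weight q M).
Local Notation leads := (leading q M).
Local Notation Q := #|K|.
Implicit Types (f g k r : {poly {poly K}}) (u : K * K).

Definition affine_points : {set K * K} := [set u | u.2 ^+ q + u.2 == u.1 ^+ M].
Definition evalK (u : K * K) : {poly {poly K}} -> K := eval2 idfun u.1 u.2.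

Lemma card_affine_points : #|affine_points| = (q * Q)%N.
Proof.
rewrite -sum1_card (partition_big (fun u : K * K => u.1) predT) //=.
under eq_bigr => a _.
  rewrite (reindex_onto (fun b => (a, b)) (fun u : K * K => u.2)) /=; last first.
    by move=> [a' b'] /= /andP[_ /eqP ->].
  rewrite (eq_bigl [pred b : K | b ^+ q + b == a ^+ M]); last first.
    by move=> b; rewrite !inE /= !eqxx !andbT.
  rewrite sum1_card fibre_card; over.
by rewrite sum_nat_const mulnC.
Qed.

(** On each fibre the coefficients of r vanish for degree reasons, hence at every
    element of K. *)
Lemma vanishing_multiple r : (size r <= q)%N ->
  (forall u, u \in affine_points -> evalK u r = 0) ->
  exists k, r = ('X^Q - 'X)%:P * k.
Proof.
move=> sr van.
have root_all j a : root r`_j a.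
  have H : map_poly (horner_eval a) r = 0.
    apply: (roots_geq_poly_eq0 (rs := enum [pred b : K | b ^+ q + b == a ^+ M])).
    - apply/allP => b; rewrite mem_enum inE => ab.
      have := van (a, b); rewrite inE => /(_ ab).
      rewrite /evalK /eval2 => /rootP; congr root; apply/polyP => i.
      by rewrite !coef_map /= map_poly_id.
    - exact: enum_uniq.
    - by rewrite -cardE fibre_card (leq_trans (size_poly _ _)).
  have /(congr1 (fun P : {poly K} => P`_j)) := H; rewrite coef_map coef0 => /= e.
  exact/rootP.
have dvd j : ('X^Q - 'X) %| r`_j.
  rewrite finField_genPoly; apply: uniq_roots_dvdp; first by apply/allP => a _; apply: root_all.
  by rewrite uniq_rootsE index_enum_uniq.
exists (\poly_(i < size r) (r`_i %/ ('X^Q - 'X))); apply/polyP => i.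
rewrite coefCM coef_poly; case: ltnP => [_|si]; last by rewrite mulr0 nth_default.
by rewrite mulrC divpK.
Qed.

(** Let (i0, j0) be the leading exponents of f. Consider the monomials x^i y^j, with
    j < q and i < Q, whose product with x^i0 y^j0 has a reduced leading monomial of
    degree less than Q in x; the reduction replaces y^q by x^M. There are at least
    q Q - weight of them. If f had more zeros than its weight, there would be more
    such monomials than points off the zeros of f, and a combination g of them
    would vanish at these points. Then f g = (x^Q - x) k on the curve, and the
    leading monomial of f g has degree at least Q in x, a contradiction. *)
Lemma zero_bound f i0 j0 : leads f i0 j0 ->
  (#|[set u in affine_points | evalK u f == 0%R]| <= wt i0 j0)%N.
Proof.
move=> lf; have [j0q _ _] := lf; rewrite leqNgt; apply/negP => Zbig.
pose Lam : {set 'I_q * 'I_Q} :=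
  [set p : 'I_q * 'I_Q | (p.2 + (i0 + if (p.1 + j0 < q)%N then 0 else M) < Q)%N].
pose off := [set u in affine_points | evalK u f != 0].
have cardLam : (q * Q <= #|Lam| + wt i0 j0)%N.
  have -> : #|Lam| = (\sum_(j < q) (Q - (i0 + if (j + j0 < q)%N then 0 else M)))%N.
    rewrite -sum1_card (partition_big (fun u : 'I_q * 'I_Q => u.1) predT) //=.
    apply: eq_bigr => j _; rewrite -card_ord_add -sum1_card.
    rewrite (reindex_onto (fun i => (j, i)) (fun u : 'I_q * 'I_Q => u.2)) /=; last first.
      by move=> [a' b'] /= /andP[_ /eqP ->].
    by apply: eq_bigl => i; rewrite !inE /= !eqxx !andbT.
  have sum_if : (\sum_(j < q) (if (j + j0 < q)%N then 0 else M) = M * j0)%N.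
    rewrite (eq_bigr (fun j : 'I_q => if ~~ (j + j0 < q)%N then M else 0%N)); last first.
      by move=> j _; rewrite if_neg.
    rewrite -big_mkcond /= (eq_bigl (fun j => j \in ~: [set j : 'I_q | (j + j0 < q)%N])).
      rewrite sum_nat_const cardsCs finset.setCK card_ord card_ord_add.
      by rewrite subKn ?(ltnW j0q) // mulnC.
    by move=> j; rewrite !inE.
  have sum_i0 : (\sum_(j < q) i0 = q * i0)%N by rewrite sum_nat_const card_ord.
  have sum_Q : (\sum_(j < q) Q = q * Q)%N by rewrite sum_nat_const card_ord.
  rewrite /weight -sum_if -sum_i0 -sum_Q -!big_split /=.
  by apply: leq_sum => j _; lia.
(* off consists of the points where g has to vanish. *)
have card_off : (#|off| < #|Lam|)%N.
  have := cardsID [set u | evalK u f == 0] affine_points.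
  rewrite card_affine_points.
  have -> : affine_points :&: [set u | evalK u f == 0] =
    [set u in affine_points | evalK u f == 0] by apply/setP => u; rewrite !inE.
  have -> : affine_points :\: [set u | evalK u f == 0] = off.
    by apply/setP => u; rewrite !inE andbC.
  by move: Zbig cardLam; move: (wt _ _) (q * Q)%N #|off| #|Lam| #|_| => a b c d e; lia.
have [c [[t ct] cLam csol]] := underdetermined_system
  (fun (p : 'I_q * 'I_Q) (u : K * K) => u.1 ^+ p.2 * u.2 ^+ p.1) card_off.
pose g := boxpoly c.
have g_neq0 : g != 0.
  by apply: contraNneq ct => g0; rewrite -coef_boxpoly_in -/g g0 !coef0.
have [i1 [j1 lg]] := leading_exists M_def g_neq0 (size_boxpoly c).
have [j1q g10 _] := lg.
have [[p1 p2] /= [e1 e2] /cLam pLam] := coef_boxpoly_neq0 g10.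
pose r := curve_mod q M (f * g).
have er : ev r = ev f * ev g by rewrite eval2_curve_mod // eval2M.
have r_neq0 : r != 0.
  apply: contraTneq (ev_leading_neq0 q_gt1 M_def x_tr xy lf) => r0.
  have := er; rewrite r0 eval2_0 => /esym/eqP; rewrite mulf_eq0.
  by rewrite (negPf (ev_leading_neq0 q_gt1 M_def x_tr xy lg)) orbF => /eqP ->; rewrite eqxx.
have sr : (size r <= q)%N by apply: size_curve_mod.
have [|k rk] := vanishing_multiple sr.
  move=> u uS; rewrite /evalK eval2_curve_mod // ?eval2M; last by move: uS; rewrite inE => /eqP.
  have [f0|f0] := eqVneq (evalK u f) 0; first by rewrite -/(evalK u f) f0 mul0r.
  rewrite eval2_boxpoly /= csol ?mulr0 //.
  by rewrite !inE f0 andbT; rewrite inE in uS.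
have k_neq0 : k != 0 by apply: contraNneq r_neq0 => k0; rewrite rk k0 mulr0.
have sk : (size k <= q)%N.
  by have := sr; rewrite rk size_Cmul // finField_genPoly monic_neq0 ?monic_prod_XsubC.
have [i2 [j2 lk]] := leading_exists M_def k_neq0 sk.
have [i3 [j3 lr]] := leading_exists M_def r_neq0 sr.
have lX : leads (('X^Q - 'X)%:P : {poly {poly K}}) Q 0.
  have sX : size ('X^Q - 'X : {poly K}) = Q.+1.
    by rewrite size_polyDl size_polyXn // size_polyN size_polyX ltnS finRing_gt1.
  have X0 : 'X^Q - 'X != 0 :> {poly K} by rewrite -size_poly_eq0 sX.
  by have := leading_polyC M (ltnW q_gt1) X0; rewrite sX.
have wfg := weight_product q_gt1 M_def x_tr xy gen lf lg lr (esym er).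
have wXk : (wt Q 0 + wt i2 j2 = wt i3 j3)%N.
  by apply: (weight_product q_gt1 M_def x_tr xy gen lX lk lr); rewrite -eval2M -rk.
have [j2q _ _] := lk.
move: pLam; rewrite inE /= -e1 -e2 => i1Q.
have wE : wt (Q + i2) j2 = (wt i0 j0 + wt i1 j1)%N by rewrite wfg -wXk /weight; lia.
case: (ltnP (j1 + j0) q) i1Q => [lt_q|ge_q] i1Q.
  have /(weight_inj M_def j2q lt_q)[] : wt (Q + i2) j2 = wt (i0 + i1) (j1 + j0).
    by rewrite wE /weight; lia.
  by lia.
have lt_q : (j1 + j0 - q < q)%N by lia.
have /(weight_inj M_def j2q lt_q)[] : wt (Q + i2) j2 = wt (i0 + i1 + M) (j1 + j0 - q).
  have e : (M * j0 + M * j1 = M * (j1 + j0 - q) + q * M)%N.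
    by rewrite [(q * M)%N]mulnC -!mulnDr subnK // addnC.
  by rewrite wE /weight; lia.
by lia.
Qed.

End ZeroBound.

(** * One-point codes on the curve *)

Lemma boxpolyE (K : fieldType) n m (f : {poly {poly K}}) :
  (forall i j, f`_j`_i != 0 -> (j < n)%N && (i < m)%N) ->
  f = boxpoly (fun p : 'I_n * 'I_m => f`_p.1`_p.2).
Proof.
move=> in_box; set c := (fun _ => _); apply/polyP => j; apply/polyP => i.
have [/andP[jn im]|out] := boolP ((j < n)%N && (i < m)%N).
  pose p : 'I_n * 'I_m := (Ordinal jn, Ordinal im).
  by rewrite -[RHS]/((boxpoly c)`_p.1`_p.2) coef_boxpoly_in.
have -> : f`_j`_i = 0 by apply/eqP; apply: contraNT out; apply: in_box.
apply/esym/eqP; apply: contraNT out => /coef_boxpoly_neq0[p [-> ->] _].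
by rewrite !ltn_ord.
Qed.

Section CurveCode.
Variables (K : finFieldType) (F : fieldType) (iota : {rmorphism K -> F}).
Variables (q s M : nat) (x y : F).
Hypotheses (q_gt1 : (1 < q)%N) (M_def : M = (q * s + 1)%N).
Hypothesis x_tr : ~ algebraicOver iota x.
Hypothesis xy : y ^+ q + y = x ^+ M.
Hypothesis gen : forall z : F, exists f (d : {poly K}),
  d != 0 /\ z = eval2 iota x y f / eval2 iota x y d%:P.
Hypothesis q_pchar : [pchar K].-nat q.
Hypothesis fibre_card : forall a : K, #|[pred b : K | b ^+ q + b == a ^+ M]| = q.

Local Notation ev := (eval2 iota x y).
Local Notation wt := (weight q M).
Local Notation leads := (leading q M).
Local Notation Q := #|K|.
Local Notation affine_points := (@affine_points K q M).
Implicit Types (P : place iota) (f g r : {poly {poly K}}).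

Let M_gt0 : (0 < M)%N. Proof. by rewrite M_def addn1. Qed.

Let Gamma := enum [pred b : K | b ^+ q + b == 0 ^+ M].
Let Gamma_uniq : uniq Gamma. Proof. exact: enum_uniq. Qed.
Let Gamma_size : size Gamma = q. Proof. by rewrite -cardE fibre_card. Qed.
Let Gamma_root (b : K) : b \in Gamma -> b ^+ q + b = 0.
Proof. by rewrite mem_enum inE expr0n gtn_eqF // => /eqP. Qed.

Lemma rational_point_place u : u \in affine_points ->
  exists P, [/\ ~ infinite x P, rational_place P & forall f, place_eval P (ev f) = evalK u f].
Proof.
rewrite inE => /eqP u_on.
have [N N0 NE] := finite_field_exp K.
have p0 : 'X - u.1%:P != 0 :> {poly K} by rewrite polyXsubC_eq0.
have p_min d : ((map_poly idfun d).[u.1] == 0) = ('X - u.1%:P %| d).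
  by rewrite map_poly_id // dvdp_XsubCl.
exists (curve_place q_gt1 M_def x_tr xy gen q_pchar Gamma_uniq Gamma_size
    Gamma_root N0 NE u_on p0 p_min); split.
- exact: curve_place_finite.
- by apply: curve_place_rational => e; exists e.
- by move=> f; apply: curve_place_eval.
Qed.

(** y is integral over K[x]. *)
Lemma affine_ring P f : ~ infinite x P -> place_ring P (ev f).
Proof.
move=> /contrapT Px.
have Py : place_ring P y.
  apply: (@place_ring_integral _ _ _ P ('X^q + ('X - (x ^+ M)%:P))).
  - by rewrite monicE lead_coefDl ?lead_coefXn // size_polyXn size_XsubC ltnS.
  - by rewrite /root !(hornerD, hornerN, hornerXn, hornerX, hornerC) addrA xy subrr.
  - move=> i; rewrite coefD coefB coefXn coefX coefC.
    have Pn (b : bool) : place_ring P b%:R.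
      by case: b; [apply: place_ring1 | apply: place_ring0].
    apply: place_ringD => //; apply: place_ringB => //.
    by case: ifP => _; [apply: place_ringX | apply: place_ring0].
rewrite (eval2_coef2 _ _ _ (leqnn _) (size_coef_xsize f)).
apply: place_ring_sum => p _; apply: place_ringM; first exact: place_ring_iota.
by apply: place_ringM; apply: place_ringX.
Qed.

Lemma curve_function_field : function_field iota.
Proof.
exists x => //; exists q, (fun j => y ^+ j) => z; have [f [d [d0 zE]]] := gen z.
pose r := curve_mod q M f.
exists (fun j : 'I_q => (map_poly iota r`_j).[x] / (map_poly iota d).[x]).
  by move=> j; exists r`_j, d.
rewrite zE -(eval2_curve_mod q_gt1 _ _ xy) (eval2_coef _ _ _ (size_curve_mod M q_gt1 f)).
by rewrite big_distrl /= eval2_polyC; apply: eq_bigr => j _; rewrite mulrAC.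
Qed.

(** An algebraic element lies in all the valuation rings, so it is a polynomial
    without pole at infinity: its leading monomial is 1. *)
Lemma full_constants : full_constant_field iota.
Proof.
move=> z [p p0 pz].
have zP P : place_ring P z.
  pose r := (lead_coef p)^-1 *: p.
  have lp : lead_coef p != 0 by rewrite lead_coef_eq0.
  apply: (@place_ring_integral _ _ _ P (map_poly iota r)).
  - by rewrite monic_map // monicE lead_coefZ mulVf.
  - by rewrite map_polyZ rootZ ?fmorph_eq0 ?invr_eq0.
  - by move=> i; rewrite coef_map; apply: place_ring_iota.
have [f zf] : exists f, z = ev f.
  apply: (regular_polynomial q_gt1 M_def x_tr xy gen q_pchar Gamma_uniq Gamma_size Gamma_root).
  by move=> P _; apply: valuation_ge0.
pose r := curve_mod q M f.
have zr : z = ev r by rewrite zf eval2_curve_mod.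
have [r0|r0] := eqVneq r 0; first by exists 0; rewrite zr r0 eval2_0 rmorph0.
have [i0 [j0 lr]] := leading_exists M_def r0 (size_curve_mod M q_gt1 f).
have [P Pinf] := infinite_place_exists x_tr.
have := valuation_ge0 (zP P); rewrite zr (infinite_valuation q_gt1 M_def x_tr xy gen Pinf lr).
rewrite oppr_ge0 lez_nat leqn0 => /eqP w0.
exists r`_0`_0; rewrite -(eval2_const iota x y); congr (ev _).
have [j0q _ dom] := lr.
have van i j : r`_j`_i != 0 -> (i, j) = (0, 0)%N.
  have [ei ej] : i0 = 0%N /\ j0 = 0%N by move: w0; rewrite /weight; lia.
  have -> : (0, 0)%N = (i0, j0) by rewrite ei ej.
  move=> rij; apply/eqP; apply: contraT => ne.
  by have := dom _ _ rij ne; rewrite w0.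
apply/polyP => j; apply/polyP => i; rewrite coefC.
have [rij|/van[-> ->]] := eqVneq r`_j`_i 0; last by rewrite coefC.
case: (j =P 0%N) rij => [->|_] rij; last by rewrite coef0.
by rewrite coefC; case: eqP rij => [->|].
Qed.

Section Points.
Variables (N : nat) (pt : 'I_N -> K * K) (m : nat).
Hypotheses (pt_inj : injective pt) (pt_on : forall i, pt i \in affine_points).
Hypotheses (N_def : N = (q * Q)%N) (m_lt : (m < N)%N).

Local Notation Box := ('I_q * 'I_m.+1)%type.
Implicit Type c : Box -> K.

Definition low_weight : {set Box} := [set p : Box | (wt p.2 p.1 <= m)%N].
Definition supported c := forall p, c p != 0 -> p \in low_weight.

Lemma low_weight_poly f : (size f <= q)%N -> (forall i j, f`_j`_i != 0 -> (wt i j <= m)%N) ->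
  exists2 c, supported c & f = boxpoly c.
Proof.
move=> sf wf; exists (fun p : Box => f`_p.1`_p.2); last first.
  apply: boxpolyE => i j fij; apply/andP; split.
    by have [_ lj] := coef2_neq0 fij; apply: leq_trans lj sf.
  rewrite ltnS (leq_trans (leq_pmull i (ltnW q_gt1))) //.
  exact: leq_trans (leq_addr _ _) (wf _ _ fij).
by move=> p fp; rewrite inE; apply: wf.
Qed.

Lemma boxpoly_weight c i j : supported c -> (boxpoly c)`_j`_i != 0 -> (wt i j <= m)%N.
Proof. by move=> sc /coef_boxpoly_neq0[p [-> ->] /sc]; rewrite inE. Qed.

Variables (Pinf : place iota) (Pinf_inf : infinite x Pinf).
Let G : divisor iota := << m%:Z *g Pinf >>.

Let coeffG P : coeff P G = if P == Pinf then m%:Z else 0.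
Proof. by rewrite coeffU [P == _]eq_sym; case: (Pinf == P); rewrite ?mulr1 ?mulr0. Qed.

(** A function with poles only at infinity is a reduced polynomial, and the bound on
    the pole order bears on its leading monomial, hence on all its monomials. *)
Lemma riemann_roch_boxpoly z :
  riemann_roch_space G z <-> exists2 c, supported c & z = ev (boxpoly c).
Proof.
split=> [[->|zG]|[c sc ->]].
- exists (fun=> 0); first by move=> p; rewrite eqxx.
  by rewrite /boxpoly big1 ?eval2_0 // => p _; rewrite scale0r polyC0 mul0r.
- have [f zf] : exists f, z = ev f.
    apply: (regular_polynomial q_gt1 M_def x_tr xy gen q_pchar Gamma_uniq Gamma_size Gamma_root).
    move=> P Pfin; have := zG P; rewrite coeffG; case: eqP => [e|_]; last by rewrite addr0.
    by case: Pfin; rewrite e.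
  pose r := curve_mod q M f.
  have zr : z = ev r by rewrite zf eval2_curve_mod.
  have sr : (size r <= q)%N by apply: size_curve_mod.
  have [|c sc rc] := low_weight_poly sr; last by exists c => //; rewrite zr rc.
  have [r0|r0] := eqVneq r 0; first by move=> i j; rewrite r0 !coef0 eqxx.
  have [i0 [j0 lr]] := leading_exists M_def r0 sr.
  have := zG Pinf; rewrite coeffG eqxx zr (infinite_valuation q_gt1 M_def x_tr xy gen Pinf_inf lr).
  rewrite addrC subr_ge0 lez_nat => le_m i j rij; apply: leq_trans le_m.
  have [_ _ dom] := lr; have [[-> ->]//|ne] := eqVneq (i, j) (i0, j0).
  exact/ltnW/dom.
- have [g0|g0] := eqVneq (boxpoly c) 0; first by left; rewrite g0 eval2_0.
  right=> P; rewrite coeffG; case: eqP => [->|ne]; last first.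
    rewrite addr0; apply/valuation_ge0/affine_ring => Pi; apply: ne.
    exact: (infinite_unique q_gt1 M_def x_tr xy gen).
  have [i0 [j0 lg]] := leading_exists M_def g0 (size_boxpoly c).
  rewrite (infinite_valuation q_gt1 M_def x_tr xy gen Pinf_inf lg) addrC subr_ge0 lez_nat.
  by have [_ g00 _] := lg; apply: boxpoly_weight g00.
Qed.

Definition word f : 'rV[K]_N := \row_i evalK (pt i) f.

Definition zeros (w : 'rV[K]_N) : {set 'I_N} := [set i | w 0 i == 0].

Lemma card_zeros f i0 j0 : leads f i0 j0 ->
  (#|zeros (word f)| <= wt i0 j0)%N.
Proof.
move=> lf; apply: leq_trans (zero_bound q_gt1 M_def x_tr xy gen fibre_card lf).
rewrite -(card_imset _ pt_inj); apply: subset_leq_card; apply/fintype.subsetP => _ /imsetP[i + ->].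
by rewrite !inE mxE => ->; rewrite andbT; have := pt_on i; rewrite inE.
Qed.

Lemma card_zeros_boxpoly c : supported c -> (exists p, c p != 0) ->
  (#|zeros (word (boxpoly c))| <= m)%N.
Proof.
move=> sc [p cp].
have g0 : boxpoly c != 0 by apply: contraNneq cp => g0; rewrite -coef_boxpoly_in g0 !coef0.
have [i0 [j0 lg]] := leading_exists M_def g0 (size_boxpoly c).
by apply: leq_trans (card_zeros lg) _; have [_ g00 _] := lg; apply: boxpoly_weight g00.
Qed.

Definition monomial_word (p : Box) : 'rV[K]_N := \row_i ((pt i).1 ^+ p.2 * (pt i).2 ^+ p.1).

Lemma word_boxpoly c : word (boxpoly c) = \sum_p c p *: monomial_word p.
Proof.
apply/rowP => i; rewrite mxE /evalK eval2_boxpoly summxE; apply: eq_bigr => p _.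
by rewrite !mxE.
Qed.

Lemma word_boxpoly_supported c : supported c ->
  word (boxpoly c) = \sum_(i < #|low_weight|) c (enum_val i) *: monomial_word (enum_val i).
Proof.
move=> sc; rewrite word_boxpoly -(big_enum_val (fun p => c p *: monomial_word p)) /=.
rewrite [RHS]big_mkcond /=; apply: eq_bigr => p _; case: ifPn => // pA.
by have [->|/sc] := eqVneq (c p) 0; rewrite ?scale0r // (negPf pA).
Qed.

Definition monomial_words : (#|low_weight|).-tuple 'rV[K]_N :=
  [tuple monomial_word (enum_val i) | i < #|low_weight|].

Definition curve_code : {vspace 'rV[K]_N} := <<monomial_words>>%VS.

Let nth_words (i : 'I_#|low_weight|) : monomial_words`_i = monomial_word (enum_val i).
Proof. by rewrite -tnth_nth tnth_mktuple. Qed.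

Lemma mem_curve_code w : w \in curve_code <-> exists2 c, supported c & w = word (boxpoly c).
Proof.
split=> [/coord_span e|[c sc ->]].
  have [c sc ec] := extend_by_zero (fun i => coord monomial_words i w).
  exists c => //; rewrite word_boxpoly_supported // [LHS]e.
  by apply: eq_bigr => i _; rewrite ec nth_words.
rewrite word_boxpoly_supported //; apply: memv_suml => i _; apply: memvZ.
by apply: memv_span; rewrite -nth_words mem_nth // size_tuple.
Qed.

(** As m < N, a nonzero combination of the monomials cannot vanish at all N points. *)
Lemma dim_curve_code : \dim curve_code = #|low_weight|.
Proof.
suff /eqP : free monomial_words by rewrite size_tuple.
apply/freeP => v v0; have [c sc ec] := extend_by_zero v.
move=> i; rewrite -ec; apply/eqP; apply: contraLR m_lt => ci; rewrite -leqNgt.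
apply: leq_trans (card_zeros_boxpoly sc _); last by exists (enum_val i).
have -> : word (boxpoly c) = 0.
  rewrite word_boxpoly_supported // -[RHS]v0.
  by apply: eq_bigr => k _; rewrite ec nth_words.
rewrite -[X in (X <= _)%N]card_ord -cardsT; apply: subset_leq_card.
by apply/fintype.subsetP => k _; rewrite inE mxE.
Qed.

Lemma hamming_dist_zeros (w w' : 'rV[K]_N) :
  hamming_dist w w' = (N - #|zeros (w - w')|)%N.
Proof.
have := cardC [pred i | w 0 i == w' 0 i]; rewrite card_ord => cN; rewrite -[X in (X - _)%N]cN.
have -> : #|zeros (w - w')| = #|[pred i | w 0 i == w' 0 i]|.
  by apply: eq_card => i; rewrite !inE !mxE subr_eq0.
by rewrite addKn; apply: eq_card.
Qed.

Lemma curve_code_distance w w' : w \in curve_code -> w' \in curve_code -> w != w' ->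
  (N - m <= hamming_dist w w')%N.
Proof.
move=> wC w'C ne; have := memvB wC w'C => /mem_curve_code[c sc e].
rewrite hamming_dist_zeros e; apply: leq_sub2l; apply: card_zeros_boxpoly => //.
apply: contrapT => H; move/eqP: ne; apply; apply/eqP; rewrite -subr_eq0 e word_boxpoly.
apply/eqP; rewrite big1 // => p _; have [->|cp] := eqVneq (c p) 0; rewrite ?scale0r //.
by case: H; exists p.
Qed.

Lemma evalK_polyY (h : {poly K}) u : evalK u (map_poly polyC h) = h.[u.2].
Proof.
have sh : (size (map_poly polyC h) <= size h)%N by apply: size_poly.
rewrite /evalK (eval2_coef _ _ _ sh) horner_coef.
by apply: eq_bigr => i _; rewrite coef_map /= map_polyC hornerC.
Qed.

Lemma pt_onto : [set pt i | i : 'I_N] = affine_points.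
Proof.
apply/eqP; rewrite eqEcard card_imset // card_ord (card_affine_points fibre_card).
rewrite -N_def leqnn andbT.
by apply/fintype.subsetP => _ /imsetP[i _ ->].
Qed.

(** The product of the y - b for b in bs vanishes at the points (a, b) with a^M = 1,
    and there are M of them for each factor, which has a pole of order M. *)
Lemma curve_code_attained (bs : seq K) :
  uniq bs -> (forall b, b \in bs -> b ^+ q + b = 1) -> #|[pred a : K | a ^+ M == 1]| = M ->
  (size bs < q)%N -> m = (size bs * M)%N ->
  exists w w', [/\ w \in curve_code, w' \in curve_code, w != w' &
    hamming_dist w w' = (N - m)%N].
Proof.
move=> ubs bs1 cM sbs mE; pose h := \prod_(b <- bs) ('X - b%:P).
pose f := map_poly polyC h.
have sh : size h = (size bs).+1 by rewrite size_prod_XsubC.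
have sf : (size f <= q)%N by apply: leq_trans (size_poly _ _) _; rewrite sh.
have [|c sc fc] := low_weight_poly sf.
  move=> i j fij; have [_ jf] := coef2_neq0 fij.
  have jb : (j <= size bs)%N by rewrite -ltnS -sh; apply: leq_trans jf (size_poly _ _).
  have i0 : i = 0%N.
    by move: fij; rewrite coef_map coefC /=; case: (i =P 0%N) => // _; rewrite eqxx.
  by rewrite i0 /weight muln0 add0n mE mulnC leq_mul2r jb orbT.
have wC : word f \in curve_code by apply/mem_curve_code; exists c; rewrite ?fc.
have card_f : #|zeros (word f)| = m.
  rewrite -(card_imset _ pt_inj).
  have -> : [set pt i | i in zeros (word f)] = [set u in affine_points | u.2 \in bs].
    apply/setP => u; rewrite !inE -root_prod_XsubC -/h /root.
    apply/imsetP/andP => [[i + ->]|[u_on hu]].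
      by rewrite inE mxE evalK_polyY => ->; have := pt_on i; rewrite inE.
    have : u \in affine_points by rewrite inE.
    by rewrite -pt_onto => /imsetP[i _ ui]; exists i; rewrite // inE mxE -ui evalK_polyY.
  rewrite -sum1_card (partition_big (fun u : K * K => u.2) (mem bs)) /=; last first.
    by move=> u; rewrite inE => /andP[].
  rewrite mE -(card_uniqP ubs) -sum_nat_const; apply: eq_bigr => b bb.
  rewrite (reindex_onto (fun a => (a, b)) (fun u : K * K => u.1)) /=; last first.
    by move=> [a' b'] /= /andP[_ /eqP ->].
  rewrite -[RHS]cM -sum1_card; apply: eq_bigl => a.
  by rewrite !inE /= !eqxx bb !andbT bs1 // eq_sym.
exists (word f), 0; split=> //; first exact: mem0v.
  apply: contraTneq m_lt => w0; rewrite -leqNgt -card_f w0 -[X in (X <= _)%N]card_ord -cardsT.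
  by apply: subset_leq_card; apply/fintype.subsetP => i _; rewrite inE mxE.
by rewrite hamming_dist_zeros subr0 card_f.
Qed.

Lemma curve_code_is_ag : is_ag_code curve_code.
Proof.
have [P PP] := choice (fun i => rational_point_place (pt_on i)).
exists F, iota, P, G; split.
- by split; [apply: curve_function_field | apply: full_constants].
- move=> i k e; apply: pt_inj.
  have [_ _ evi] := PP i; have [_ _ evk] := PP k.
  have := evi 'X%:P; have := evi 'X; rewrite e !evk /evalK !eval2_Y !eval2_X.
  by case: (pt i) (pt k) => [a b] [a' b'] /= -> ->.
- by move=> i; have [] := PP i.
- move=> i; rewrite mem_dom negbK coeffG; case: (P i =P Pinf) => [e|_] //.
  by have [Pi _ _] := PP i; case: Pi; rewrite e.
move=> w; rewrite mem_curve_code; split.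
  move=> [c sc ->]; exists (ev (boxpoly c)); first by apply/riemann_roch_boxpoly; exists c.
  by apply/rowP => i; rewrite !mxE; have [_ _ ->] := PP i.
move=> [z /riemann_roch_boxpoly[c sc ->] <-]; exists c => //.
by apply/rowP => i; rewrite !mxE; have [_ _ ->] := PP i.
Qed.

End Points.

End CurveCode.

(** * The parameters *)

Lemma sum_arith_progression a s : (\sum_(j < a) ((a.-1 - j) * s + 1) = a + 'C(a, 2) * s)%N.
Proof.
rewrite big_split /= sum_nat_const card_ord muln1 addnC; congr (_ + _)%N.
rewrite -big_distrl /= -bin2_sum big_mkord; congr (_ * _)%N.
rewrite (reindex_inj rev_ord_inj) /=; apply: eq_bigr => j _.
by have := ltn_ord j; lia.
Qed.

Lemma mul_pred_bin2 a : (a * (a - 1) = 'C(a, 2) * 2)%N.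
Proof.
rewrite bin2 muln2 halfK subn1 oddM; case: a => [|b] //=.
by case: (odd b); rewrite subn0.
Qed.

(** For M = q s + 1 and j < a <= q, the condition q i + M j <= (a - 1) M amounts to
    i <= (a - 1 - j) s, as a - 1 - j < q. *)
Lemma card_low_weight q s M a : (0 < a)%N -> (a <= q)%N -> M = (q * s + 1)%N ->
  #|low_weight q M (a.-1 * M)| = (a + 'C(a, 2) * s)%N.
Proof.
move=> a0 aq M_def; set m := (a.-1 * M)%N.
rewrite -sum1_card (partition_big (fun p : 'I_q * 'I_m.+1 => p.1) predT) //=.
rewrite (eq_bigr (fun j : 'I_q => if (j < a)%N then ((a.-1 - j) * s + 1)%N else 0%N)).
  by rewrite -big_mkcond (big_ord_narrow aq) /= sum_arith_progression.
move=> j _.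
rewrite (reindex_onto (fun i => (j, i)) (fun p : 'I_q * 'I_m.+1 => p.2)) /=; last first.
  by move=> [j' i'] /= /andP[_ /eqP ->].
rewrite (eq_bigl (fun i : 'I_m.+1 => (i < if (j < a)%N then (a.-1 - j) * s + 1 else 0)%N)).
  set k := (if _ then _ else _); have km : (k <= m.+1)%N.
    rewrite /k; case: ifP => // ja; rewrite addn1 ltnS /m M_def.
    by apply: leq_mul; [apply: leq_subr | rewrite addn1 leqW // leq_pmull // (leq_trans a0)].
  by rewrite (big_ord_narrow km) /= sum1_card card_ord.
move=> i; rewrite !inE /= !eqxx !andbT /weight; move: (nat_of_ord i) => {}i; rewrite /m.
case: ifPn => [ja|]; last first.
  rewrite -leqNgt => aj; rewrite ltn0; apply/negbTE; rewrite -ltnNge.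
  by apply: leq_trans (leq_addl _ _); rewrite [(M * j)%N]mulnC ltn_pmul2r ?M_def ?addn1 //; lia.
have [d ad] : exists d, a.-1 = (j + d)%N by exists (a.-1 - j)%N; lia.
have dq : (d < q)%N by lia.
rewrite ad addKn addn1 ltnS mulnDl [(M * j)%N]mulnC addnC leq_add2l M_def mulnDr muln1.
apply/idP/idP => [H|H]; last by nia.
rewrite leqNgt; apply/negP => H2.
have : (q * (d * s).+1 <= q * i)%N by rewrite leq_mul2l H2 orbT.
by lia.
Qed.

Local Close Scope ring_scope.
Theorem corollary5p3 (q n a : nat) (K : finFieldType)
    (q_pp : prime_power q) (q_ge3 : 3 <= q)
    (n_gt0 : 0 < n) (n_odd : odd n)
    (a_ge2 : 2 <= a) (a_le : a <= q - 1)
    (cardK : #|K| = q ^ (2 * n)) :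
  exists C : {vspace 'rV[K]_(q ^ (2 * n + 1))},
    is_ag_code C /\
    code_parameters C (a + (a * (a - 1) * q ^ (n - 1)) %/ 2)
                      (q ^ (2 * n + 1) - (q ^ n + 1) * (a - 1)).
Proof.
have q_gt1 : 1 < q by apply: leq_trans q_ge3.
have q_gt0 : 0 < q by apply: ltnW.
pose M := q ^ n + 1; pose s := q ^ (n - 1).
have M_def : M = q * s + 1 by rewrite /M /s -expnS subn1 prednK.
have q_pchar : ([pchar K]%R).-nat q.
  have [p [e [pr_p e_gt0 qE]]] := q_pp.
  have p_pchar : p \in [pchar K]%R.
    by apply: (@card_finPcharP _ p (e * (2 * n))); rewrite // cardK qE -expnM.
  by rewrite qE pnatX pnatE // p_pchar.
have fibre_card (c : K) : #|[pred b : K | (b ^+ q + b == c ^+ M)%R]| = q.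
  apply: (card_artin_schreier q_pchar n_odd cardK) => //.
  rewrite -exprM /M mulnDl mul1n exprD -expnD addnn -mul2n -cardK expf_card.
  by rewrite exprD mulrC.
have M_dvd : M %| #|K|.-1.
  apply/dvdnP; exists (q ^ n - 1); rewrite cardK mul2n -addnn expnD -subn1 /M.
  by rewrite mulnBl mulnDr muln1 mul1n; lia.
have M_gt0 : 0 < M by rewrite /M addn1.
have [F [iota [x [y [x_tr xy gen]]]]] := artin_schreier_field K M q_gt1.
have [Pinf Pinf_inf] := infinite_place_exists x_tr.
have cardS : #|affine_points K q M| = q ^ (2 * n + 1).
  by rewrite (card_affine_points fibre_card) cardK addn1 expnS.
pose pt (i : 'I_(q ^ (2 * n + 1))) := enum_val (cast_ord (esym cardS) i).
have pt_inj : injective pt by move=> i k /enum_val_inj /cast_ord_inj.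
have pt_on i : pt i \in affine_points K q M by apply: enum_valP.
have N_def : q ^ (2 * n + 1) = q * #|K| by rewrite cardK addn1 expnS.
have m_lt : a.-1 * M < q ^ (2 * n + 1).
  have qn : 1 < q ^ n by apply: leq_trans q_gt1 _; rewrite -{1}(expn1 q) leq_pexp2l.
  rewrite N_def cardK mul2n -addnn expnD; apply: (@leq_trans (q * M)).
    by rewrite ltn_pmul2r //; lia.
  by rewrite leq_mul2l /M; apply/orP; right; nia.
exists (curve_code q M pt (a.-1 * M)); split.
  exact: (curve_code_is_ag q_gt1 M_def x_tr xy gen q_pchar fibre_card _ pt_inj
    pt_on Pinf_inf).
split.
  rewrite (dim_curve_code q_gt1 M_def x_tr xy gen fibre_card pt_inj pt_on m_lt).
  rewrite (card_low_weight _ _ M_def); [|lia|lia].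
  congr (_ + _); rewrite -/s.
  by rewrite mul_pred_bin2 mulnAC mulnK.
have -> : (q ^ n + 1) * (a - 1) = a.-1 * M by rewrite mulnC subn1.
split; last first.
  by move=> w w'; apply: (curve_code_distance q_gt1 M_def x_tr xy gen fibre_card pt_inj pt_on).
(* The right-hand side is 1, written as 1^M to match the fibre over x = 1. *)
pose roots1 := enum [pred b : K | (b ^+ q + b == 1 ^+ M)%R].
have size_roots1 : size roots1 = q by rewrite -cardE fibre_card.
apply: (curve_code_attained q_gt1 fibre_card pt_inj pt_on N_def m_lt
  (bs := take a.-1 roots1)).
- exact/take_uniq/enum_uniq.
- by move=> b /mem_take; rewrite mem_enum inE expr1n => /eqP.
- exact: card_unity_roots.
- by rewrite size_take size_roots1; case: ifP => //; lia.
- by rewrite size_take size_roots1 ifT //; lia.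
Qed.
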